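(* Let $T: C^p(X,E)\to C^q(Y,F)$ be a separating, nowhere trivial continuous linear operator. If $q > p$, then there is a partition of $Y$ into clopen subsets $(Y_\alpha)$ so that the support map of $T$ is constant on each $Y_\alpha$.
   Context: $G,H,E,F$ are real Banach spaces; $X\subseteq G$ and $Y\subseteq H$ are open; $1\le p\le\infty$, $0\le q\le\infty$. $\mathbb{N}_p=\{i\in\mathbb{N}\cup\{0\}: i\le p\}$ (all nonnegative integers if $p=\infty$). $\mathcal{S}^k(G,E)$ is the Banach space of bounded symmetric $k$-linear maps $G^k\to E$, with $\mathcal{S}^0(G,E)=E$. $C^p(X,E)$ is the space of all $f:X\to E$ such that for all $k\in\mathbb{N}_p$ the Fréchet derivative $D^kf$ ($D^0f=f$) is a continuous function from $X$ to $\mathcal{S}^k(G,E)$; $C^p(X)=C^p(X,\mathbb{R})$. $C^p(X,E)$ carries the topology generated by the seminorms $\rho_{K,k}(f)=\sup_{x\in K}\sup_{0\le j\le k}\|D^jf(x)\|$, $K\subseteq X$ compact, $k\in\mathbb{N}_p$; similarly for $C^q(Y,F)$. Standing assumption: there is a bump function $\varphi\in C^p(G)=C^p(G,\mathbb{R})$ with $\varphi(x)=1$ if $\|x\|\le 1/2$, $\varphi(x)=0$ if $\|x\|\ge1$, and $\sup_{x\in G}\|D^k\varphi(x)\|<\infty$ for all $k\in\mathbb{N}_p$. Two functions are disjoint if at every point at least one of them is $0$. A map $T$ is separating if it maps disjoint functions to disjoint functions. $T$ is nowhere trivial if for every $y\in Y$ there is $f\in C^p(X,E)$ with $Tf(y)\ne0$.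 Support map: let $\mathbb{R}_\infty$ be the one-point compactification of $\mathbb{R}$, $i:X\to\mathbb{R}_\infty^{C^p(X)}$, $i(x)(\psi)=\psi(x)$ (a homeomorphic embedding), and let $\mathcal{A}X$ be the closure of $i(X)$. For $f\in C^p(X,E)$ let $\overline{C}(f)$ be the closure in $\mathcal{A}X$ of $i(\{x:f(x)\ne0\})$. For $y\in Y$ let $\mathcal{O}_y$ be the family of open subsets $U$ of $\mathcal{A}X$ for which there is $f\in C^p(X,E)$ with $Tf(y)\ne0$ and $\overline{C}(f)\subseteq U$. Then $h(y)$ is the unique point of $\bigcap\{\overline{U}^{\mathcal{A}X}:U\in\mathcal{O}_y\}$; for $T$ continuous, separating and nowhere trivial, $h(y)\in i(X)$, and $i(X)$ is identified with $X$, so that the support map is a (continuous) map $h:Y\to X$. *)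

(* Defs.v *)
From HB Require Import structures.
From mathcomp Require Import all_boot all_order all_algebra perm.
From mathcomp Require Import all_classical all_reals topology normedtype derive.
Set Implicit Arguments.
Unset Strict Implicit.
Unset Printing Implicit Defensive.
Import Order.TTheory GRing.Theory Num.Theory numFieldNormedType.Exports.
Local Open Scope classical_set_scope.
Local Open Scope ring_scope.

(* Orders of smoothness are elements of \bar int, so that +oo is allowed. *)
Definition N_ (p : \bar int) : set nat := [set k | (k%:Z%:E <= p)%E].

Section SymmetricMaps.
Context {R : realType} (k : nat) (G E : normedModType R).
Implicit Types (A : ('I_k -> G) -> E) (v : 'I_k -> G).

Definition multilinear A :=
  forall v i, linear (fun x : G => A [eta v with i |-> x] : E).

Definition symmetric_map A := forall v (s : 'S_k), A (v \o s) = A v.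

Definition bounded_multi A :=
  exists C : R, forall v, `|A v| <= C * \prod_(i < k) `|v i|.

Definition bsm : {pred ('I_k -> G) -> E} :=
  fun A => `[< [/\ multilinear A, symmetric_map A & bounded_multi A] >].

(* symmap k G E is S^k(G, E); it is normed by opnorm below. *)
Record symmap := SymMap { symmap_val :> ('I_k -> G) -> E ;
                          symmap_valP : symmap_val \in bsm }.

HB.instance Definition _ := [isSub for symmap_val].
HB.instance Definition _ := [Choice of symmap by <:].

Lemma bsm_submod_closed : submod_closed bsm.
Proof.
split=> [|a A B /asboolP[mA sA [C bA]] /asboolP[mB sB [D bB]]]; apply/asboolP.
  split=> [v i a x y|//|]; first by rewrite /= scaler0 addr0.
  by exists 0 => v; rewrite normr0 mul0r.
split=> [v i b x y|v s|].
- have -> : forall w, (a *: A + B) w = a *: A w + B w by [].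
  have -> : forall w, (a *: A + B) w = a *: A w + B w by [].
  rewrite mA mB scalerDr !scalerA (mulrC a b) -!scalerA [RHS]/=.
  by rewrite scalerDr addrACA.
- have E0 : forall w, (a *: A + B) w = a *: A w + B w by [].
  by rewrite !E0 sA sB.
- exists (`|a| * C + D) => v.
  rewrite (le_trans (ler_normD _ _))// normrZ mulrDl -mulrA.
  by rewrite lerD// ler_wpM2l.
Qed.

HB.instance Definition _ :=
  GRing.isSubmodClosed.Build R (('I_k -> G) -> E) bsm bsm_submod_closed.
HB.instance Definition _ := [SubChoice_isSubLmodule of symmap by <:].

Implicit Types S : symmap.

Definition opnorm S : R :=
  sup [set `|S v| | v in [set v | forall i, `|v i| <= 1]].

Lemma symmapD S1 S2 v : (S1 + S2) v = S1 v + S2 v. Proof. by []. Qed.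

Lemma symmapZ a S v : (a *: S) v = a *: S v. Proof. by []. Qed.

Lemma symmapP S1 S2 : (forall v, S1 v = S2 v) -> S1 = S2.
Proof. by move=> e; apply/val_inj/funext. Qed.

Let unit_set S := [set `|S v| | v in [set v | forall i, `|v i| <= 1]].

Let unit_neq0 S : unit_set S !=set0.
Proof. by exists `|S (fun=> 0)|, (fun=> 0) => //= i; rewrite normr0. Qed.

Let unit_ub S : has_ubound (unit_set S).
Proof.
have /asboolP[_ _ [C CS]] := symmap_valP S.
exists `|C| => _ [v v1 <-]; rewrite (le_trans (CS v))//.
rewrite (le_trans (ler_wpM2r _ (ler_norm C))) ?prodr_ge0// ler_piMr//.
by apply: prodr_ile1 => i _; rewrite normr_ge0 v1.
Qed.

Let opnorm_ub S v : (forall i, `|v i| <= 1) -> `|S v| <= opnorm S.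
Proof. by move=> v1; apply: (ub_le_sup (unit_ub S)); exists v. Qed.

Let opnorm_le S (r : R) :
  (forall v, (forall i, `|v i| <= 1) -> `|S v| <= r) -> opnorm S <= r.
Proof. by move=> h; apply: (ge_sup (unit_neq0 S)) => _ [v /h ? <-]. Qed.

Lemma opnormD S1 S2 : opnorm (S1 + S2) <= opnorm S1 + opnorm S2.
Proof.
apply: opnorm_le => v v1; rewrite symmapD (le_trans (ler_normD _ _))//.
by rewrite lerD// opnorm_ub.
Qed.

Let opnormZ_le (a : R) S : opnorm (a *: S) <= `|a| * opnorm S.
Proof.
by apply: opnorm_le => v v1; rewrite symmapZ normrZ ler_wpM2l// opnorm_ub.
Qed.

Lemma opnormZ (a : R) S : opnorm (a *: S) = `|a| * opnorm S.
Proof.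
apply/le_anti; rewrite opnormZ_le/=.
have [->|a0] := eqVneq a 0.
  rewrite normr0 mul0r (le_trans (normr_ge0 ((0 *: S) (fun=> 0))))//.
  by apply: opnorm_ub => i; rewrite normr0.
rewrite -[in leLHS](scalerK a0 S) -ler_pdivlMl ?normr_gt0// -normfV.
exact: opnormZ_le.
Qed.

Lemma multilinear_scale S (c : 'I_k -> R) v :
  S (fun i => c i *: v i) = (\prod_(i < k) c i) *: S v.
Proof.
have /asboolP[mS _ _] := symmap_valP S.
have mZ w i (a : R) x :
    S [eta w with i |-> a *: x] = a *: S [eta w with i |-> x].
  have := mS w i a x 0; rewrite addr0 => ->.
  have := mS w i (-1) 0 0; rewrite scaleN1r oppr0 addr0.
  by rewrite scaleN1r addrC subrr => ->; rewrite addr0.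
have step (s : seq 'I_k) : uniq s ->
    S (fun i => if i \in s then c i *: v i else v i) =
    (\prod_(i <- s) c i) *: S v.
  elim: s => [_|j s IH /= /andP[js us]].
    by rewrite big_nil scale1r; congr (S _); apply/funext => i.
  rewrite big_cons -scalerA -(IH us).
  transitivity (S [eta (fun i => if i \in s then c i *: v i else v i)
      with j |-> c j *: v j]).
    congr (S _); apply/funext => i; rewrite inE /=.
    by case: eqVneq => // ->.
  rewrite mZ; congr (_ *: S _); apply/funext => i /=.
  by case: eqVneq => // ->; rewrite (negbTE js).
rewrite -big_enum/= -(step _ (enum_uniq _)); congr (S _); apply/funext => i.
by rewrite mem_enum.
Qed.

Lemma opnorm0_eq0 S : opnorm S = 0 -> S = 0.
Proof.
move=> S0; apply: symmapP => v.
have c0 i : 1 + `|v i| != 0 by rewrite gt_eqF// ltr_pwDl.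
have -> : v = (fun i => (1 + `|v i|) *: ((1 + `|v i|)^-1 *: v i)).
  by apply/funext => i; rewrite scalerA divff// scale1r.
rewrite (multilinear_scale S (fun i => 1 + `|v i|)).
rewrite [X in _ *: X](_ : _ = 0) ?scaler0//.
apply/eqP; rewrite -normr_le0 -S0; apply: opnorm_ub => i.
rewrite normrZ normfV gtr0_norm ?ltr_pwDl// ler_pdivrMl ?ltr_pwDl// mulr1.
by rewrite lerDr.
Qed.

HB.instance Definition _ :=
  Lmodule_isNormed.Build R symmap opnormD opnormZ opnorm0_eq0.

End SymmetricMaps.

Definition vcons {T : Type} (k : nat) (x : T) (v : 'I_k -> T) : 'I_k.+1 -> T :=
  fun i => if unlift ord0 i is Some j then v j else x.

(* symmap 0 G E plays the role of S^0(G, E) = E, isometrically: its elements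
   are functions of the empty family of vectors. *)
Section ConstantMap.
Context {R : realType} (G E : normedModType R) (e : E).

Lemma symmap0_subproof : (fun=> e : E) \in @bsm R 0 G E.
Proof.
apply/asboolP; split=> [v []//|//|]; exists `|e| => v.
by rewrite big_ord0 mulr1.
Qed.

Definition symmap0 : symmap 0 G E := SymMap symmap0_subproof.

End ConstantMap.

Section Derivatives.
Context {R : realType} {G E : normedModType R} {X : set G}.

(* Here F : X -> S^k(G, E) is Frechet differentiable at x, and A is its derivative
   under the identification of L(G, S^k(G, E)) with (k+1)-linear maps:
   A (v, w_1, .., w_k) = F'(x)(v)(w_1, .., w_k). F is extended by 0 outside X,
   which is harmless when X is open, as is always assumed. *)
Definition is_frechet k (F : X -> symmap k G E) (x : X)
    (A : symmap k.+1 G E) : Prop :=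
  differentiable ('valL_0 F) (val x) /\
  forall v w, A (vcons v w) = ('d ('valL_0 F) (val x) v : symmap k G E) w.

(* The value 0 is a dummy, used where the derivative does not exist. *)
Fixpoint Dn k (f : X -> E) : X -> symmap k G E :=
  match k with
  | 0 => fun x => symmap0 G (f x)
  | k'.+1 => fun x => xget 0 [set A | is_frechet (Dn k' f) x A]
  end.

Definition Cp (p : \bar int) : {pred X -> E} := fun f =>
  `[< forall k, N_ p k -> continuous (Dn k f) /\
      forall j, (j < k)%N -> forall x, is_frechet (Dn j f) x (Dn j.+1 f x) >].

End Derivatives.

Lemma is_frechet_unique {R : realType} {G E : normedModType R} {X : set G} k
  (F : X -> symmap k G E) x A B : is_frechet F x A -> is_frechet F x B -> A = B.
Proof.
move=> [_ hA] [_ hB]; apply: symmapP => v.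
have -> : v = vcons (v ord0) (fun i => v (lift ord0 i)).
  by apply/funext => i; rewrite /vcons; case: unliftP => [j ->|->].
by rewrite hA hB.
Qed.

Section DnLinear.
Context {R : realType} {G E : normedModType R} {X : set G}.
Implicit Types f g : X -> E.

Let valL0_lin (a : R) k (F H : X -> symmap k G E) :
  'valL_0 (a *: F + H) = a *: 'valL_0 F + 'valL_0 H.
Proof.
apply/funext => y.
rewrite -[RHS]/(a *: 'valL_0 F y + 'valL_0 H y) /valL_/=.
by case: ('oinv_set_val y) => //=; rewrite scaler0 addr0.
Qed.

Lemma is_frechet_lin (a : R) k (F H : X -> symmap k G E) x A B :
  is_frechet F x A -> is_frechet H x B ->
  is_frechet (a *: F + H) x (a *: A + B).
Proof.
move=> [dF hA] [dH hB].
have dZ := differentiableZ a dF.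
split; first by rewrite valL0_lin; exact: differentiableD.
move=> v w; rewrite valL0_lin.
have eD := congr1 (fun h => h v : symmap k G E) (diffD dZ dH).
have eZ := congr1 (fun h => h v : symmap k G E) (diffZ a dF).
rewrite [in RHS](etrans eD (congr1 (+%R^~ _) eZ)).
by transitivity (a *: A (vcons v w) + B (vcons v w)); last rewrite hA hB.
Qed.

Lemma DnS k f x A : is_frechet (Dn k f) x A -> Dn k.+1 f x = A.
Proof.
by move=> hA; apply: xget_subset1 => // B C; exact: is_frechet_unique.
Qed.

Lemma Dn_lin (a : R) k f g :
  (forall j, (j < k)%N -> forall x, is_frechet (Dn j f) x (Dn j.+1 f x)) ->
  (forall j, (j < k)%N -> forall x, is_frechet (Dn j g) x (Dn j.+1 g x)) ->
  Dn k (a *: f + g) = a *: Dn k f + Dn k g.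
Proof.
elim: k => [|k IH] hf hg; first by apply/funext => x; exact: symmapP.
apply/funext => x; apply: DnS; rewrite IH; last 2 first.
- by move=> j jk; apply: hf; exact: ltnW.
- by move=> j jk; apply: hg; exact: ltnW.
by apply: is_frechet_lin; [exact: hf|exact: hg].
Qed.

End DnLinear.

Section CpSpace.
Context {R : realType} {G : completeNormedModType R} (p : \bar int)
  (X : set G) (E : completeNormedModType R).

(* CpType p X E is C^p(X, E); X : set G is used as a type, with the subspace
   topology. *)
Record CpType := CpFun { Cp_val :> X -> E ; Cp_valP : Cp_val \in Cp p }.

HB.instance Definition _ := [isSub for Cp_val].
HB.instance Definition _ := [Choice of CpType by <:].

Lemma Cp_submod_closed : submod_closed (Cp p : {pred X -> E}).
Proof.
have Dn0 k : Dn k (0 : X -> E) = 0 /\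
    forall j, (j < k)%N -> forall x : X,
      is_frechet (Dn j (0 : X -> E)) x (Dn j.+1 (0 : X -> E) x).
  elim: k => [|k [IH1 IH2]].
    by split=> //; apply/funext => x; exact: symmapP.
  have fr (x : X) : is_frechet (Dn k (0 : X -> E)) x 0.
    rewrite IH1 /is_frechet.
    have -> : 'valL_0 (0 : X -> symmap k G E) = cst 0.
      by apply/funext => y; rewrite /valL_/=; case: ('oinv_set_val y).
    split; first exact: differentiable_cst.
    by move=> v w; rewrite diff_cst.
  split; first by apply/funext => x; exact: DnS.
  move=> j; rewrite ltnS leq_eqVlt => /predU1P[-> x|]; last exact: IH2.
  by rewrite (DnS (fr x)).
split=> [|a f g /asboolP hf /asboolP hg]; apply/asboolP => k kp.
  by have [e h] := Dn0 k; split=> //; rewrite e; exact: (@cst_continuous _ _ (0 : symmap k G E)).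
have [cf df] := hf k kp; have [cg dg] := hg k kp.
split.
  rewrite Dn_lin// => x.
  exact: (cvgD (cvgZl_tmp (k := a) (cf x)) (cg x)).
move=> j jk x.
have df' i : (i < j)%N -> forall x, is_frechet (Dn i f) x (Dn i.+1 f x).
  by move=> ij; apply: df; exact: ltn_trans jk.
have dg' i : (i < j)%N -> forall x, is_frechet (Dn i g) x (Dn i.+1 g x).
  by move=> ij; apply: dg; exact: ltn_trans jk.
rewrite Dn_lin//.
have fr := is_frechet_lin a (df j jk x) (dg j jk x).
by rewrite (_ : Dn j.+1 _ x = a *: Dn j.+1 f x + Dn j.+1 g x)//; apply: DnS;
  rewrite Dn_lin.
Qed.

HB.instance Definition _ :=
  GRing.isSubmodClosed.Build R (X -> E) (Cp p) Cp_submod_closed.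
HB.instance Definition _ := [SubChoice_isSubLmodule of CpType by <:].
HB.instance Definition _ := isPointed.Build CpType 0.

(* The supremum over the empty set is 0. *)
Definition rho (K : set X) (k : nat) (f : CpType) : R :=
  sup [set r | exists x j, [/\ K x, (j <= k)%N & r = `|Dn j f x|]].

(* The topology generated by the seminorms rho K k, with K compact and k in N_p:
   their open balls form a subbase. *)
Definition seminorm_balls : set (set CpType) :=
  [set U | exists K k f e, [/\ compact K, N_ p k, 0 < e &
                               U = [set g | rho K k (g - f) < e]]].

HB.instance Definition _ :=
  isSubBaseTopological.Build CpType seminorm_balls id.

End CpSpace.

Section Bump.
Context {R : realType} (G : completeNormedModType R) (p : \bar int).

Definition has_bump := exists phi : CpType p [set: G] R^o,
  [/\ forall x, `|val x| <= 2^-1 -> phi x = 1,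
      forall x, 1 <= `|val x| -> phi x = 0 &
      forall k, N_ p k -> has_ubound (range (fun x => `|Dn k phi x|))].

End Bump.

Section Compactification.
Context {R : realType} {G E : completeNormedModType R} (p : \bar int)
  (X : set G).

Definition cube := {ptws CpType p X R^o -> one_point_compactification R}.

Definition embX (x : X) : cube := fun psi => Some (psi x).

Definition AX : set cube := closure (range embX).

Definition Cbar (f : CpType p X E) : set AX :=
  closure [set u : AX | exists2 x, f x != 0 & val u = embX x].

End Compactification.

Arguments cube {R G} p X.
Arguments AX {R G} p X.
Arguments embX {R G} p {X} x.

Section SupportMap.
Context {R : realType} {G H E F : completeNormedModType R} {p q : \bar int}
  {X : set G} {Y : set H} (T : CpType p X E -> CpType q Y F).

Definition separating := forall f g : CpType p X E,
  (forall x, f x = 0 \/ g x = 0) -> forall y, T f y = 0 \/ T g y = 0.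

Definition nowhere_trivial := forall y, exists f, T f y != 0.

Definition Ofam (y : Y) : set (set (AX p X)) :=
  [set U | open U /\ exists f, T f y != 0 /\ Cbar f `<=` U].

(* h y is the unique point of the intersection; X is identified with its image
   in AX p X under embX. *)
Definition is_support_map (h : Y -> X) := forall y,
  \bigcap_(U in Ofam y) closure U = [set u : AX p X | val u = embX p (h y)].

End SupportMap.

(* Main.v *)
Require Import Defs.
From HB Require Import structures.
From mathcomp Require Import all_boot all_order all_algebra perm finmap.
From mathcomp Require Import all_classical all_reals interval_inference.
From mathcomp Require Import topology normedtype derive landau.
From mathcomp Require Import ring.
Set Implicit Arguments.
Unset Strict Implicit.
Unset Printing Implicit Defensive.
Import Order.TTheory GRing.Theory Num.Theory numFieldNormedType.Exports.
Local Open Scope classical_set_scope.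
Local Open Scope ring_scope.

(** Since p < q, p is a finite number m, and T takes values in functions that
    are at least C^(m+1). The support point h(y) is the only point x such that
    the functions supported in any ball around x suffice to make the functional
    f |-> Tf(y) nonzero (support_pt). It exists because continuity of T bounds
    Tf(y) by the derivatives of f on a compact set, on which bump functions
    clear f ball by ball (support_pt_exists). Since T is separating, Tf(y) = 0
    as soon as f vanishes near it (support_pt_local), and the coordinates of
    the compactification then identify it with the intersection that defines
    the support map (support_pt_bigcap).

    That h is locally constant comes from one estimate (T_escape_bound). Let
    y and y' lie on a segment of Y, let f be fixed, and let f_r be f multiplied
    by the bump of radius r around h(y). Derivatives of f_r up to order m are
    O(r^-m), so, by continuity of T, the derivative of order m+1 of T f_r is
    O(r^-m) on the segment. If h(y') is at distance more than r from h(y), then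
    T f_r vanishes near y', and Taylor's formula at y' gives
    |Tf(y)| = |T f_r (y)| = O(r^-m |y - y'|^(m+1)). When |Tf| is bounded below,
    the choice r = e |y - y'| makes this impossible for y' close to y, whatever
    e > 0 is. So h has derivative zero along the segment, hence is constant on
    it (mean_value_norm). The level sets of a locally constant map are clopen
    and partition Y.

    The products f_r have to be shown C^m with controlled derivatives of every
    order. Derivatives are therefore handled as functions of a list of vectors:
    D^k f(x)(v_1, .., v_k) is written J x [:: v_1; ..; v_k], uniformly in k. In
    this form Leibniz' rule is a recursion on the list (leibniz), and being C^m
    amounts to estimates on J (jet) that are stable under this product. *)

(** * Symmetric multilinear maps and Frechet derivatives *)

Lemma N_leq (p : \bar int) j k : N_ p k -> (j <= k)%N -> N_ p j.
Proof. by move=> pk jk; apply: le_trans pk; rewrite lee_fin lez_nat. Qed.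

Section OperatorNorm.
Context {R : realType} (k : nat) (G E : normedModType R).
Implicit Types S : symmap k G E.

(** The operator norm is a supremum over unit balls; multilinearity extends the
    bound to all vectors by rescaling each of them to norm at most 1. *)
Lemma symmap_norm_apply S v : `|S v| <= `|S| * \prod_(i < k) `|v i|.
Proof.
pose u i := `|v i|^-1 *: v i.
have uE : v = (fun i => `|v i| *: u i).
  apply/funext => i; rewrite /u scalerA.
  have [->|v0] := eqVneq (v i) 0; first by rewrite scaler0.
  by rewrite divff ?normr_eq0// scale1r.
have u1 i : `|u i| <= 1.
  rewrite /u normrZ normfV normr_id.
  have [->|v0] := eqVneq (v i) 0; first by rewrite normr0 mulr0.
  by rewrite mulVf ?normr_eq0.
rewrite [in leLHS]uE (multilinear_scale S (fun i => `|v i|)) normrZ.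
rewrite ger0_norm ?prodr_ge0// mulrC ler_wpM2r ?prodr_ge0//.
have /asboolP[_ _ [C CS]] := symmap_valP S.
apply: ub_le_sup; last by exists u.
exists `|C| => _ [w w1 <-]; rewrite (le_trans (CS w))//.
rewrite (le_trans (ler_wpM2r _ (ler_norm C))) ?prodr_ge0// ler_piMr//.
by apply: prodr_ile1 => i _; rewrite normr_ge0 w1.
Qed.

Lemma symmap_opnorm_le S (C : R) : 0 <= C ->
  (forall v, `|S v| <= C * \prod_(i < k) `|v i|) -> `|S| <= C.
Proof.
move=> C0 h; apply: ge_sup.
  by exists `|S (fun=> 0)|, (fun=> 0) => //= i; rewrite normr0.
move=> _ [v v1 <-]; rewrite (le_trans (h v))// ler_piMr//.
by apply: prodr_ile1 => i _; rewrite normr_ge0 v1.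
Qed.

End OperatorNorm.

Section Curry.
Context {R : realType} (k : nat) (G E : normedModType R).
Variable A : symmap k.+1 G E.

Lemma vcons0 {T : Type} (x : T) (w : 'I_k -> T) : vcons x w ord0 = x.
Proof. by rewrite /vcons unlift_none. Qed.

Lemma vconsS {T : Type} (x : T) (w : 'I_k -> T) i :
  vcons x w (lift ord0 i) = w i.
Proof. by rewrite /vcons liftK. Qed.

Lemma symmap_curry_subproof x : (fun w => A (vcons x w)) \in @bsm R k G E.
Proof.
have /asboolP[mA sA [C bA]] := symmap_valP A.
apply/asboolP; split.
- move=> w i a y z.
  have e t : vcons x [eta w with i |-> t] =
      [eta (vcons x w) with lift ord0 i |-> t].
    apply/funext => j; have [j' ->|->] := unliftP ord0 j.
      by rewrite vconsS /= (inj_eq lift_inj) vconsS.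
    by rewrite /= !vcons0.
  by rewrite !e mA.
- move=> w s; rewrite -[RHS](sA _ (lift_perm ord0 ord0 s)); congr (A _).
  apply/funext => j; have [j' ->|->] := unliftP ord0 j.
    by rewrite /= lift_perm_lift !vconsS.
  by rewrite /= lift_perm_id !vcons0.
- exists (C * `|x|) => w; rewrite (le_trans (bA _))// big_ord_recl vcons0.
  rewrite mulrA; under eq_bigr do rewrite vconsS.
  by [].
Qed.

Definition symmap_curry x : symmap k G E := SymMap (symmap_curry_subproof x).

Lemma symmap_curry_linear : linear symmap_curry.
Proof.
have /asboolP[mA _ _] := symmap_valP A.
move=> a x y; apply: symmapP => w.
have e t : vcons t w = [eta (vcons 0 w) with ord0 |-> t].
  apply/funext => j; have [j' ->|->] := unliftP ord0 j.
    by rewrite /= !vconsS.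
  by rewrite /= vcons0.
by rewrite symmapD symmapZ /= (e (_ + _)) mA -!e.
Qed.

HB.instance Definition _ :=
  GRing.isLinear.Build R G (symmap k G E) _ symmap_curry symmap_curry_linear.

Lemma symmap_curry_norm x : `|symmap_curry x| <= `|A| * `|x|.
Proof.
apply: symmap_opnorm_le => [|w]; first exact: mulr_ge0.
rewrite (le_trans (symmap_norm_apply A (vcons x w)))// big_ord_recl vcons0 mulrA.
by under eq_bigr do rewrite vconsS.
Qed.

Lemma symmap_curry_continuous : continuous symmap_curry.
Proof.
apply: bounded_linear_continuous; apply/linear_boundedP.
near=> r => x; rewrite (le_trans (symmap_curry_norm x))// ler_wpM2r//.
Unshelve. all: by end_near. Qed.

End Curry.

Section FrechetEpsilon.
Context {R : realType}.

(** The little-o form of differentiability with a candidate derivative L known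
    in advance, so that existence and value are handled at once. *)
Lemma diff_epsP (V W : normedModType R) (g : V -> W) (x : V)
    (L : {linear V -> W}) : continuous L ->
  (differentiable g x /\ 'd g x = L :> (V -> W)) <->
  forall e, 0 < e ->
    \forall z \near x, `|g z - g x - L (z - x)| <= e * `|z - x|.
Proof.
move=> cL; split=> [[dg gL] e e0|h].
  have /diff_locally/eqaddoP/(_ e e0) := dg.
  rewrite [\forall x \near _, _ <= _](near_shift x) sub0r gL.
  by apply: filterS => z /=; rewrite !fctE /= subrK opprD addrA.
have ho : g \o shift x = cst (g x) + L +o_ 0 id.
  apply/eqaddoP => e e0.
  rewrite [\forall x \near _, _ <= _](near_shift x) sub0r.
  apply: filterS (h e e0) => z.
  by rewrite /= !fctE /= subrK opprD addrA.
have dE := diff_unique cL ho.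
by split=> //; apply/diff_locallyP; rewrite dE.
Qed.

Context (k : nat) {G E : normedModType R} {X : set G}.
Implicit Types (F : X -> symmap k G E) (x : X).

Lemma valL0_val F x : 'valL_0 F (val x) = F x.
Proof. by have := congr1 (@^~ x) (valLK 0 F). Qed.

(** The estimate is uniform in w, up to the product of the norms, because this
    is what the operator norm measures. *)
Lemma is_frechetP F x (A : symmap k.+1 G E) : is_frechet F x A <->
  forall e, 0 < e -> \forall z \near val x, forall w,
    `|('valL_0 F z : symmap k G E) w - F x w - A (vcons (z - val x) w)|
      <= e * `|z - val x| * \prod_(i < k) `|w i|.
Proof.
have -> : is_frechet F x A <-> (differentiable ('valL_0 F) (val x) /\
    'd ('valL_0 F) (val x) = symmap_curry A :> (G -> symmap k G E)).
  split=> -[dF hA]; split=> //; last by move=> v w; rewrite hA.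
  by apply/funext => v; apply: symmapP => w; rewrite -hA.
rewrite (diff_epsP _ _ (@symmap_curry_continuous _ _ _ _ A)) valL0_val.
set g := 'valL_0 F.
split=> h e e0; apply: filterS (h e e0) => z hz.
  move=> w; apply: le_trans (symmap_norm_apply (g z - F x -
    symmap_curry A (z - val x)) w) _.
  by rewrite ler_wpM2r// prodr_ge0.
by apply: symmap_opnorm_le => [|w]; [rewrite mulr_ge0// ltW|exact: hz].
Qed.

End FrechetEpsilon.

(** * Multilinear forms on lists of vectors *)

Section MultilinearForms.
Context {R : realType} {G E : normedModType R}.

(** A whole family of bounded symmetric k-linear maps, one for each k, as a
    single function on lists. Linearity in the head suffices, by symmetry. *)
Record mform (a : seq G -> E) : Prop := Mform {
  mform_perm : forall s t, perm_eq s t -> a s = a t ;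
  mform_lin : forall t, linear (fun x => a (x :: t)) ;
  mform_bd : forall k, exists2 C, 0 <= C &
    forall s, size s = k -> `|a s| <= C * \prod_(x <- s) `|x| }.

Lemma mform_symmap_subproof (a : seq G -> E) (ma : mform a) k :
  (fun v => a (codom v)) \in @bsm R k G E.
Proof.
apply/asboolP; split.
- move=> v i.
  have e x : a (codom [eta v with i |-> x]) =
      a (x :: [seq v j | j <- rem i (enum 'I_k)]).
    apply: (mform_perm ma).
    apply: (perm_trans (perm_map _ (perm_to_rem (mem_enum 'I_k i)))) => /=.
    rewrite eqxx perm_cons.
    rewrite (_ : map _ _ = [seq v j | j <- rem i (enum 'I_k)])//.
    apply/eq_in_map => j; rewrite mem_rem_uniq ?enum_uniq// inE => /andP[ji _].
    by rewrite /= (negbTE ji).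
  by move=> b x y; rewrite !e (mform_lin ma).
- move=> v s; apply: (mform_perm ma).
  rewrite /codom /image_mem (map_comp v s) perm_map// uniq_perm//.
  + by rewrite map_inj_uniq ?enum_uniq//; exact: perm_inj.
  + by rewrite enum_uniq.
  + move=> i; rewrite mem_enum inE; apply/mapP; exists (s^-1%g i).
      by rewrite mem_enum.
    by rewrite permKV.
- have [C _ hC] := mform_bd ma k; exists C => v.
  rewrite (le_trans (hC _ _))//; first by rewrite size_codom card_ord.
  by rewrite big_map big_enum.
Qed.

Definition mform_symmap a (ma : mform a) k : symmap k G E :=
  SymMap (mform_symmap_subproof ma k).

(** The inverse of mform_symmap. *)
Definition symmap_form (S : forall k, symmap k G E) (s : seq G) : E :=
  S (size s) (fun i => s`_i).

Lemma symmap_form_norm S s :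
  `|symmap_form S s| <= `|S (size s)| * \prod_(x <- s) `|x|.
Proof.
by rewrite (le_trans (symmap_norm_apply _ _))// (big_nth 0) big_mkord.
Qed.

Lemma symmap_form_size S s n : size s = n ->
  symmap_form S s = S n (fun i => s`_i).
Proof. by move=> <-. Qed.

Lemma symmap_form_cons S x s :
  symmap_form S (x :: s) = S (size s).+1 (vcons x (fun i : 'I_(size s) => s`_i)).
Proof.
rewrite /symmap_form /=; congr (S _ _).
apply/funext => i; have [j ->|->] := unliftP ord0 i; first by rewrite vconsS.
by rewrite vcons0.
Qed.

Lemma symmap_form_mform S : mform (symmap_form S).
Proof.
split.
- move=> s t; rewrite -[t]/(tval (in_tuple t)) => /tuple_permP[p ps].
  rewrite (@symmap_form_size S s (size t)); last by rewrite ps size_tuple.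
  rewrite /symmap_form /=.
  have /asboolP[_ sS _] := symmap_valP (S (size t)).
  rewrite -[RHS](sS _ p); congr (S _ _); apply/funext => i /=.
  by rewrite ps (nth_map i) ?size_enum_ord// nth_ord_enum (tnth_nth 0).
- move=> t b x y; rewrite !symmap_form_cons.
  have := symmap_curry_linear (S (size t).+1) b x y.
  by move=> /(congr1 (fun A : symmap _ _ _ => A (fun i => t`_i))).
- move=> k; exists `|S k| => // s <-; exact: symmap_form_norm.
Qed.

End MultilinearForms.

(** * Jets: derivatives of all orders as forms on lists *)

Lemma nbhs_set_typeP {T : topologicalType} (X : set T) (x : X) (Q : set T) :
  open X -> (\forall z \near x, Q (val z)) <-> \forall z \near val x, Q z.
Proof.
move=> oX; split=> h; last exact: (initial_continuous (f := @set_val _ X)).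
have : nbhs (val x) (X `&` Q); last by apply: filterS => z [].
have [B [[C oC CB] Bx BQ]] := h.
apply: (@filterS _ _ _ (X `&` C)).
  by move=> z [Xz Cz]; split => //; apply: (BQ (SigSub (mem_set Xz))); rewrite -CB.
apply: open_nbhs_nbhs; split; first exact: openI.
by split; [exact: set_valP|rewrite -CB in Bx].
Qed.

Lemma nbhs_set_type_ball {R : realType} {V : normedModType R} (X : set V)
    (x : X) (A : set X) : nbhs x A ->
  exists2 r : R, 0 < r & forall z : X, `|val z - val x| < r -> A z.
Proof.
move=> [_ [[C oC <-] Cx CA]].
have /nbhs_ballP[r r0 hr] : nbhs (val x) C by exact: open_nbhs_nbhs.
exists r => // z zx; apply: CA; apply: hr.
by rewrite -ball_normE /= distrC.
Qed.

Lemma near_ltn {T : Type} (F : set_system T) {FF : Filter F}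
    (P : nat -> T -> Prop) n :
  (forall k, (k < n)%N -> \forall z \near F, P k z) ->
  \forall z \near F, forall k, (k < n)%N -> P k z.
Proof.
elim: n => [_|n IH h]; first by apply: filterE => z k.
have h1 : \forall z \near F, forall k, (k < n)%N -> P k z.
  by apply: IH => k kn; apply: h; exact: ltnW.
apply: filterS2 h1 (h n (ltnSn n)) => z hz hn k.
by rewrite ltnS leq_eqVlt => /predU1P[->//|]; exact: hz.
Qed.

Section Jets.
Context {R : realType} {G E : normedModType R}.

(** J x consists of the derivatives at x of x |-> J x [::]: for lists shorter
    than m, putting z - x at the head of the list gives the first order
    variation of J at x. The estimates are relative to the product of the norms
    of the list, which makes them estimates in operator norm. *)
Record jet (m : nat) (X : set G) (J : G -> seq G -> E) : Prop := Jet {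
  jet_mform : forall x, X x -> mform (J x) ;
  jet_diff : forall x, X x -> forall k, (k < m)%N -> forall e, 0 < e ->
    \forall z \near x, forall s, size s = k ->
      `|J z s - J x s - J x (z - x :: s)| <= e * `|z - x| * \prod_(y <- s) `|y| ;
  jet_cont : forall x, X x -> forall k, (k <= m)%N -> forall e, 0 < e ->
    \forall z \near x, forall s, size s = k ->
      `|J z s - J x s| <= e * \prod_(y <- s) `|y| }.

Context {X : set G}.

Definition taylor (f : X -> E) (x : G) : seq G -> E :=
  symmap_form (fun k => 'valL_0 (Dn k f) x).

Lemma taylor0 f (x : X) : taylor f (val x) [::] = f x.
Proof. by rewrite /taylor /symmap_form valL0_val. Qed.

Lemma taylor_norm f (x : X) s :
  `|taylor f (val x) s| <= `|Dn (size s) f x| * \prod_(y <- s) `|y|.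
Proof. by rewrite (le_trans (symmap_form_norm _ _))// valL0_val. Qed.

Lemma taylor_jet p m (f : X -> E) : open X -> f \in Cp p -> N_ p m ->
  jet m X (taylor f).
Proof.
move=> oX /asboolP fC pm; split=> [x _|x0 Xx0 k km e e0|x0 Xx0 k km e e0].
- exact: symmap_form_mform.
- have [x ->] : exists x : X, x0 = val x by exists (SigSub (mem_set Xx0)).
  have := (fC m pm).2 k km x.
  move=> /is_frechetP/(_ e e0); apply: filterS => z hz s sk; subst k.
  have := hz (fun i => s`_i).
  rewrite /taylor symmap_form_cons !valL0_val /symmap_form valL0_val.
  by rewrite (big_nth 0) big_mkord.
- have [x ->] : exists x : X, x0 = val x by exists (SigSub (mem_set Xx0)).
  have pk : N_ p k.
    by apply: (N_leq pm).
  have := (fC k pk).1 x.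
  move=> /cvgrPdist_le/(_ e e0) h.
  apply/(nbhs_set_typeP _ _ oX); apply: filterS h => z hz s sk; subst k.
  rewrite /taylor /symmap_form !valL0_val distrC.
  apply: le_trans (symmap_norm_apply (Dn (size s) f x - Dn (size s) f z) _) _.
  rewrite [in leRHS](big_nth 0) big_mkord ler_wpM2r ?prodr_ge0//.
Qed.

(** Conversely, any jet of f computes the derivatives of f, by induction on the
    order: the condition jet_diff says that the form of size k.+1 is the
    Frechet derivative of the form of size k. *)
Section JetIntro.
Variables (m : nat) (f : X -> E) (J : G -> seq G -> E).
Hypotheses (oX : open X) (jJ : jet m X J).
Hypothesis fJ : forall x : X, f x = J (val x) [::].

Let jet_frechet_symmap k (x : X) (mx : mform (J (val x))) : (k < m)%N ->
  (forall (x : X) v, Dn k f x v = J (val x) (codom v)) ->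
  is_frechet (Dn k f) x (mform_symmap mx k.+1).
Proof.
move=> km IH; apply/is_frechetP => e e0.
have := jet_diff jJ (set_valP x) km e0.
rewrite -!(nbhs_set_typeP _ _ oX); apply: filterS => z hz w.
rewrite valL0_val !IH.
have := hz (codom w); rewrite size_codom card_ord => /(_ erefl).
rewrite big_map big_enum/=.
rewrite (_ : codom (vcons _ w) = val z - val x :: codom w)//.
rewrite /codom /image_mem enum_ordSl /= vcons0; congr (_ :: _).
by rewrite -map_comp; apply: eq_map => i /=; rewrite vconsS.
Qed.

Lemma jet_Dn k : (k <= m)%N ->
  forall (x : X) v, Dn k f x v = J (val x) (codom v).
Proof.
elim: k => [_ x v|k IH km x v].
  rewrite [LHS]fJ; congr (J _ _); apply/esym/size0nil.
  by rewrite size_codom card_ord.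
have mx := jet_mform jJ (set_valP x).
by rewrite (DnS (jet_frechet_symmap mx km (IH (ltnW km)))).
Qed.

Lemma jet_Cp p : (forall k, N_ p k -> (k <= m)%N) -> f \in Cp p.
Proof.
move=> pm; apply/asboolP => k /pm km; split=> [x|j jk x].
  apply/(@cvgrPdist_le _ _ _ _ (nbhs_filter x)) => e e0.
  have := jet_cont jJ (set_valP x) km e0.
  rewrite -!(nbhs_set_typeP _ _ oX).
  apply: (@filterS _ _ (nbhs_filter x)) => z hz.
  rewrite distrC; apply: symmap_opnorm_le => [|v]; first exact: ltW.
  have := hz (codom v); rewrite size_codom card_ord => /(_ erefl).
  by rewrite big_map big_enum/= -!jet_Dn.
have mx := jet_mform jJ (set_valP x).
have jm := leq_trans jk km.
have h := jet_frechet_symmap mx jm (jet_Dn (ltnW jm)).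
by rewrite (DnS h).
Qed.

Lemma jet_Dn_norm k (x : X) C : (k <= m)%N -> 0 <= C ->
  (forall s, size s = k -> `|J (val x) s| <= C * \prod_(y <- s) `|y|) ->
  `|Dn k f x| <= C.
Proof.
move=> km C0 h; apply: symmap_opnorm_le => // v; rewrite jet_Dn//.
by rewrite (le_trans (h _ _)) ?size_codom ?card_ord// big_map big_enum.
Qed.

End JetIntro.

End Jets.

(** * Leibniz' rule *)

Section Leibniz.
Context {R : realType} {G E : normedModType R}.
Implicit Types (a : seq G -> R^o) (b : seq G -> E).

(** The form of the product of two functions with forms a and b: each vector of
    the list differentiates one factor or the other. *)
Fixpoint leibniz a b (l : seq G) : E :=
  if l is x :: l' then
    leibniz (fun s => a (x :: s)) b l' + leibniz a (fun s => b (x :: s)) l'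
  else (a [::] : R) *: b [::].

Lemma leibniz_linl a1 a2 b (c : R) l :
  leibniz (fun s => c *: a1 s + a2 s) b l = c *: leibniz a1 b l + leibniz a2 b l.
Proof.
elim: l a1 a2 b => [|x l IH] a1 a2 b /=; first by rewrite scalerDl scalerA.
by rewrite !IH scalerDr addrACA.
Qed.

Lemma leibniz_linr a b1 b2 (c : R) l :
  leibniz a (fun s => c *: b1 s + b2 s) l = c *: leibniz a b1 l + leibniz a b2 l.
Proof.
elim: l a b1 b2 => [|x l IH] a b1 b2 /=.
  by rewrite scalerDr !scalerA mulrC.
by rewrite !IH scalerDr addrACA.
Qed.

Lemma leibnizBl a1 a2 b l :
  leibniz (fun s => a1 s - a2 s) b l = leibniz a1 b l - leibniz a2 b l.
Proof.
rewrite -[RHS]addrC -scaleN1r -leibniz_linl.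
by congr leibniz; apply/funext => s; rewrite scaleN1r addrC.
Qed.

Lemma leibnizBr a b1 b2 l :
  leibniz a (fun s => b1 s - b2 s) l = leibniz a b1 l - leibniz a b2 l.
Proof.
rewrite -[RHS]addrC -scaleN1r -leibniz_linr.
by congr leibniz; apply/funext => s; rewrite scaleN1r addrC.
Qed.

(** The power of 2 counts the ways of distributing the list between the
    factors. *)
Lemma leibniz_norm a b (A B : R) l :
  (forall s, (size s <= size l)%N -> `|a s| <= A * \prod_(y <- s) `|y|) ->
  (forall s, (size s <= size l)%N -> `|b s| <= B * \prod_(y <- s) `|y|) ->
  `|leibniz a b l| <= 2 ^+ size l * (A * B) * \prod_(y <- l) `|y|.
Proof.
elim: l a b A B => [|x l IH] a b A B ha hb.
  have := ha [::] isT; have := hb [::] isT.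
  by rewrite /= big_nil normrZ !mulr1 expr0 mul1r => *; exact: ler_pM.
have ha1 s : (size s <= size l)%N ->
    `|a (x :: s)| <= (A * `|x|) * \prod_(y <- s) `|y|.
  by move=> sl; have := ha (x :: s) sl; rewrite big_cons mulrA.
have hb1 s : (size s <= size l)%N ->
    `|b (x :: s)| <= (B * `|x|) * \prod_(y <- s) `|y|.
  by move=> sl; have := hb (x :: s) sl; rewrite big_cons mulrA.
have ha2 s : (size s <= size l)%N -> `|a s| <= A * \prod_(y <- s) `|y|.
  by move=> sl; apply: ha; exact: leqW.
have hb2 s : (size s <= size l)%N -> `|b s| <= B * \prod_(y <- s) `|y|.
  by move=> sl; apply: hb; exact: leqW.
rewrite /= (le_trans (ler_normD _ _))//.
rewrite (le_trans (lerD (IH _ _ _ _ ha1 hb2) (IH _ _ _ _ ha2 hb1)))//.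
by rewrite big_cons exprS le_eqVlt; apply/orP; left; apply/eqP; ring.
Qed.

(** Two consecutive vectors can be exchanged, because the two mixed terms swap;
    so any vector can be moved to the front of the list. *)
Lemma leibniz_perm a b l1 l2 :
  (forall s t, perm_eq s t -> a s = a t) ->
  (forall s t, perm_eq s t -> b s = b t) ->
  perm_eq l1 l2 -> leibniz a b l1 = leibniz a b l2.
Proof.
have cons_perm (V : Type) (f : seq G -> V) x :
    (forall s t, perm_eq s t -> f s = f t) ->
    forall s t, perm_eq s t -> f (x :: s) = f (x :: t).
  by move=> h s t st; apply: h; rewrite perm_cons.
have swap (V : Type) (f : seq G -> V) x y :
    (forall s t, perm_eq s t -> f s = f t) ->
    (fun s => f [:: x, y & s]) = (fun s => f [:: y, x & s]).
  by move=> h; apply/funext => s; apply: h; rewrite (perm_catCA [:: x] [:: y]).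
have move_front s : forall x t a b,
    (forall s t, perm_eq s t -> a s = a t) ->
    (forall s t, perm_eq s t -> b s = b t) ->
    leibniz a b (s ++ x :: t) = leibniz a b (x :: s ++ t).
  elim: s => [//|y s IH] x t a' b' ha hb.
  rewrite cat_cons [LHS]/= !IH; try exact: cons_perm; try by [].
  by rewrite /= addrACA (swap _ a' y x) // (swap _ b' y x).
elim: l1 l2 a b => [|x l1 IH] l2 a b ha hb.
  by move=> /perm_size/esym/size0nil ->.
move=> pl; have xl2 : x \in l2 by rewrite -(perm_mem pl) mem_head.
case/splitPr: xl2 pl => s t.
rewrite perm_sym -(perm_catCA [:: x]) perm_cons perm_sym /= => pl.
rewrite move_front//=; congr (_ + _).
  by apply: IH => //; exact: cons_perm.
by apply: IH => //; exact: cons_perm.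
Qed.

Lemma mform_bd_le {V : normedModType R} (a : seq G -> V) : mform a ->
  forall k, exists2 C, 0 <= C &
    forall s, (size s <= k)%N -> `|a s| <= C * \prod_(x <- s) `|x|.
Proof.
move=> ma; elim=> [|k [C C0 hC]].
  have [C C0 hC] := mform_bd ma 0; exists C => // s.
  by rewrite leqn0 => /eqP; exact: hC.
have [D D0 hD] := mform_bd ma k.+1; exists (C + D) => [|s]; first exact: addr_ge0.
rewrite mulrDl leq_eqVlt => /predU1P[/hD|/hC] h; rewrite (le_trans h)//.
  by rewrite lerDr mulr_ge0// prodr_ge0.
by rewrite lerDl mulr_ge0// prodr_ge0.
Qed.

Lemma leibniz_mform a b : mform a -> mform b -> mform (leibniz a b).
Proof.
move=> ma mb; split.
- by move=> s t; apply: leibniz_perm; exact: mform_perm.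
- move=> t c x y /=.
  rewrite (_ : (fun s => a (_ :: s)) = fun s => c *: a (x :: s) + a (y :: s)).
    rewrite (_ : (fun s => b (_ :: s)) = fun s => c *: b (x :: s) + b (y :: s)).
      by rewrite leibniz_linl leibniz_linr scalerDr addrACA.
    by apply/funext => s; rewrite (mform_lin mb).
  by apply/funext => s; rewrite (mform_lin ma).
- move=> k; have [A A0 hA] := mform_bd_le ma k.
  have [B B0 hB] := mform_bd_le mb k.
  exists (2 ^+ k * (A * B)) => [|s sk].
    by rewrite mulr_ge0 ?exprn_ge0// mulr_ge0.
  by rewrite -sk; apply: leibniz_norm => t; rewrite sk; [exact: hA|exact: hB].
Qed.

(** The first order expansion of a product, where a1 and b1 stand for the first
    variations of a and b. By bilinearity the error is
    (a' - a)(b' - b) + (a' - a - a1) b + a (b' - b - b1). With a1 = b1 = 0 this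
    is the continuity of the product. *)
Lemma leibniz_taylor_norm (a a1 a' : seq G -> R^o) (b b1 b' : seq G -> E)
    (A B da db ea eb : R) l :
  (forall s, (size s <= size l)%N ->
    [/\ `|a s| <= A * \prod_(y <- s) `|y|,
        `|a' s - a s| <= da * \prod_(y <- s) `|y| &
        `|a' s - a s - a1 s| <= ea * \prod_(y <- s) `|y| ]) ->
  (forall s, (size s <= size l)%N ->
    [/\ `|b s| <= B * \prod_(y <- s) `|y|,
        `|b' s - b s| <= db * \prod_(y <- s) `|y| &
        `|b' s - b s - b1 s| <= eb * \prod_(y <- s) `|y| ]) ->
  `|leibniz a' b' l - leibniz a b l - (leibniz a1 b l + leibniz a b1 l)| <=
    2 ^+ size l * (da * db + ea * B + A * eb) * \prod_(y <- l) `|y|.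
Proof.
move=> ha hb.
pose da' s := a' s - a s; pose db' s := b' s - b s.
have -> : leibniz a' b' l - leibniz a b l - (leibniz a1 b l + leibniz a b1 l) =
    leibniz da' db' l + leibniz (fun s => da' s - a1 s) b l +
    leibniz a (fun s => db' s - b1 s) l.
  rewrite /da' /db' !(leibnizBl, leibnizBr).
  rewrite -[RHS]addrA [X in _ = _ + X]addrACA -opprD addrA; congr (_ - _).
  by rewrite [RHS]addrA [RHS]addrAC subrK addrA subrK.
rewrite !mulrDr !mulrDl.
rewrite (le_trans (ler_normD _ _))// lerD//.
  rewrite (le_trans (ler_normD _ _))// lerD//.
    by apply: leibniz_norm => s /[dup] /ha[? ? ?] /hb[].
  by apply: leibniz_norm => s /[dup] /ha[? ? ?] /hb[].
by apply: leibniz_norm => s /[dup] /ha[? ? ?] /hb[].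
Qed.

Lemma jet_leibniz m X (a : G -> seq G -> R^o) (b : G -> seq G -> E) :
  jet m X a -> jet m X b -> jet m X (fun x => leibniz (a x) (b x)).
Proof.
move=> ja jb; split=> [x Xx|x Xx|x Xx].
- by apply: leibniz_mform; [exact: (jet_mform ja)|exact: (jet_mform jb)].
- have [A A0 hA] := mform_bd_le (jet_mform ja Xx) m.
  have [B B0 hB] := mform_bd_le (jet_mform jb Xx) m.
  move=> k km e e0.
  (* D d bounds the factor given by leibniz_taylor_norm, since d <= 1 *)
  pose D := 2 ^+ k * (A + B + B + 1) : R.
  have D0 : 0 < D by rewrite mulr_gt0 ?exprn_gt0// ltr_wpDl// !addr_ge0.
  pose d := Num.min 1 (e / D).
  have d0 : 0 < d by rewrite lt_min ltr01 divr_gt0.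
  have d1 : d <= 1 by rewrite ge_min lexx.
  have dD : D * d <= e by rewrite mulrC -ler_pdivlMr// ge_min lexx orbT.
  have jk j : (j < k.+1)%N -> (j < m)%N by move=> /leq_trans; exact.
  have jk' j : (j < k.+1)%N -> (j <= m)%N by move=> /jk/ltnW.
  have na := near_ltn (FF := nbhs_filter x) (fun j h => jet_diff ja Xx (jk j h) d0).
  have nb := near_ltn (FF := nbhs_filter x) (fun j h => jet_diff jb Xx (jk j h) d0).
  have nc := near_ltn (FF := nbhs_filter x) (fun j h => jet_cont ja Xx (jk' j h) d0).
  apply: filterS3 na nb nc => z ha hb hc s sk.
  pose h := z - x.
  have ea : forall t, (size t <= size s)%N ->
    [/\ `|a x t| <= A * \prod_(y <- t) `|y|,
        `|a z t - a x t| <= d * \prod_(y <- t) `|y| &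
        `|a z t - a x t - a x (h :: t)| <= (d * `|h|) * \prod_(y <- t) `|y| ].
    rewrite sk => t tk; split; first by rewrite hA// (leq_trans tk)// ltnW.
      by apply: (hc (size t)).
    by apply: (ha (size t)).
  have eb : forall t, (size t <= size s)%N ->
    [/\ `|b x t| <= B * \prod_(y <- t) `|y|,
        `|b z t - b x t| <= ((d + B) * `|h|) * \prod_(y <- t) `|y| &
        `|b z t - b x t - b x (h :: t)| <= (d * `|h|) * \prod_(y <- t) `|y| ].
    rewrite sk => t tk.
    have hb' : `|b z t - b x t - b x (h :: t)| <=
        (d * `|h|) * \prod_(y <- t) `|y| by apply: (hb (size t)).
    (* differentiability makes b Lipschitz at x: the cross term is o(h) *)
    split=> //; first by rewrite hB// (leq_trans tk)// ltnW.
    rewrite -[X in `|X|](subrK (b x (h :: t))) (le_trans (ler_normD _ _))//.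
    rewrite mulrDl mulrDl lerD// (le_trans (hB _ _))//.
      exact: leq_ltn_trans tk km.
    by rewrite big_cons mulrA.
  rewrite (le_trans (leibniz_taylor_norm ea eb))// sk.
  rewrite ler_wpM2r ?prodr_ge0//.
  rewrite (_ : _ * _ = 2 ^+ k * (A + B + B + d) * d * `|h|); last by ring.
  rewrite ler_wpM2r// (le_trans _ dD)// ler_wpM2r ?ler_wpM2l ?exprn_ge0 ?(ltW d0)//.
  by rewrite lerD2l.
- have [A A0 hA] := mform_bd_le (jet_mform ja Xx) m.
  have [B B0 hB] := mform_bd_le (jet_mform jb Xx) m.
  move=> k km e e0.
  pose D := 2 ^+ k * (A + B + 1) : R.
  have D0 : 0 < D by rewrite mulr_gt0 ?exprn_gt0// ltr_wpDl// !addr_ge0.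
  pose d := Num.min 1 (e / D).
  have d0 : 0 < d by rewrite lt_min ltr01 divr_gt0.
  have d1 : d <= 1 by rewrite ge_min lexx.
  have dD : D * d <= e by rewrite mulrC -ler_pdivlMr// ge_min lexx orbT.
  have jk j : (j < k.+1)%N -> (j <= m)%N by rewrite ltnS => /leq_trans; apply.
  have na := near_ltn (FF := nbhs_filter x) (fun j h => jet_cont ja Xx (jk j h) d0).
  have nb := near_ltn (FF := nbhs_filter x) (fun j h => jet_cont jb Xx (jk j h) d0).
  apply: filterS2 na nb => z ha hb s sk.
  have ea : forall t, (size t <= size s)%N ->
    [/\ `|a x t| <= A * \prod_(y <- t) `|y|,
        `|a z t - a x t| <= d * \prod_(y <- t) `|y| &
        `|a z t - a x t - 0| <= d * \prod_(y <- t) `|y| ].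
    rewrite sk => t tk; rewrite subr0; split; first by rewrite hA// (leq_trans tk).
      by apply: (ha (size t)).
    by apply: (ha (size t)).
  have eb : forall t, (size t <= size s)%N ->
    [/\ `|b x t| <= B * \prod_(y <- t) `|y|,
        `|b z t - b x t| <= d * \prod_(y <- t) `|y| &
        `|b z t - b x t - 0| <= d * \prod_(y <- t) `|y| ].
    rewrite sk => t tk; rewrite subr0; split; first by rewrite hB// (leq_trans tk).
      by apply: (hb (size t)).
    by apply: (hb (size t)).
  have := leibniz_taylor_norm (a1 := fun=> 0) (b1 := fun=> 0) ea eb.
  (* the null form is written 0 - 0 for the sake of leibnizBl *)
  have l0 : leibniz (fun=> 0 - 0) (b x) s = 0 by rewrite leibnizBl subrr.
  have r0 : leibniz (a x) (fun=> 0 - 0) s = 0 by rewrite leibnizBr subrr.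
  rewrite subrr in l0; rewrite subrr in r0.
  rewrite l0 r0 addr0 subr0 sk => /le_trans-> //.
  rewrite ler_wpM2r ?prodr_ge0//.
  rewrite (_ : _ * _ = 2 ^+ k * (A + B + d) * d); last by ring.
  rewrite (le_trans _ dD)// ler_wpM2r ?ler_wpM2l ?exprn_ge0 ?(ltW d0)//.
  by rewrite lerD2l.
Qed.

End Leibniz.

(** * Cutting off by a rescaled bump *)

Section Dilation.
Context {R : realType} {G E : normedModType R}.

Lemma prod_norm_scale (r : R) (s : seq G) :
  \prod_(y <- [seq r *: v | v <- s]) `|y| =
  `|r| ^+ size s * \prod_(y <- s) `|y|.
Proof.
elim: s => [|x s IH]; first by rewrite !big_nil expr0 mulr1.
by rewrite /= !big_cons IH normrZ exprS; ring.
Qed.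

Lemma mform_scale (a : seq G -> E) (r : R) :
  mform a -> mform (fun s => a [seq r *: v | v <- s]).
Proof.
move=> ma; split=> [s t st|t c x y|k].
- by apply: (mform_perm ma); exact: perm_map.
- by rewrite /= -(mform_lin ma) scalerDr !scalerA (mulrC r).
- have [C C0 hC] := mform_bd ma k.
  exists (C * `|r| ^+ k) => [|s sk]; first by rewrite mulr_ge0// exprn_ge0.
  by rewrite (le_trans (hC _ _)) ?size_map// prod_norm_scale sk mulrA.
Qed.

(** The chain rule for x |-> r (x - c): every vector is scaled by r. *)
Lemma jet_scale m X (a : G -> seq G -> E) (r : R) (c : G) : 0 < r ->
  jet m setT a ->
  jet m X (fun x s => a (r *: (x - c)) [seq r *: v | v <- s]).
Proof.
move=> r0 ja.
have near_cu x (Q : set G) : (\forall u \near r *: (x - c), Q u) ->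
    \forall z \near x, Q (r *: (z - c)).
  suff cu : (fun z => r *: (z - c)) @ nbhs x --> r *: (x - c) by exact: cu.
  by apply: cvgZl_tmp; apply: cvgB; [exact: cvg_id|exact: cvg_cst].
split=> [x Xx|x Xx k km e e0|x Xx k km e e0].
- by apply: mform_scale; exact: (jet_mform ja).
- have e1 : 0 < e / r ^+ k.+1 by rewrite divr_gt0 ?exprn_gt0.
  have h := jet_diff ja (I : setT (r *: (x - c))) km e1.
  have := near_cu x _ h; apply: filterS => z hz s sk.
  have := hz [seq r *: v | v <- s] (etrans (size_map _ s) sk).
  rewrite -scalerBr opprB addrA subrK prod_norm_scale normrZ gtr0_norm// sk.
  move=> /le_trans -> //; rewrite le_eqVlt; apply/orP; left; apply/eqP.
  by rewrite exprS; field; rewrite expf_neq0 gt_eqF.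
- have e1 : 0 < e / r ^+ k by rewrite divr_gt0 ?exprn_gt0.
  have h := jet_cont ja (I : setT (r *: (x - c))) km e1.
  have := near_cu x _ h; apply: filterS => z hz s sk.
  have := hz [seq r *: v | v <- s] (etrans (size_map _ s) sk).
  rewrite prod_norm_scale gtr0_norm// sk mulrA divfK//.
  by rewrite expf_neq0// gt_eqF.
Qed.

End Dilation.

Section Cutoff.
Context {R : realType} {G E : completeNormedModType R} {X : set G}.
Context {p : \bar int} {m : nat}.
Hypotheses (oX : open X) (pm : N_ p m) (mp : forall k, N_ p k -> (k <= m)%N).
Variable phi : CpType p [set: G] R^o.

(** The jet of phi ((x - c) / r) f(x). *)
Definition cutoff_jet (c : G) (r : R) (f : CpType p X E) (x : G) : seq G -> E :=
  leibniz (fun s => taylor phi (r^-1 *: (x - c)) [seq r^-1 *: v | v <- s])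
    (taylor f x).

Lemma cutoff_jetP c r (f : CpType p X E) : 0 < r -> jet m X (cutoff_jet c r f).
Proof.
move=> r0; apply: jet_leibniz; last exact: taylor_jet oX (Cp_valP f) pm.
apply: jet_scale; first by rewrite invr_gt0.
exact: taylor_jet openT (Cp_valP phi) pm.
Qed.

Definition cutoff_fun c r (f : CpType p X E) (x : X) : E :=
  cutoff_jet c r f (val x) [::].

Lemma cutoff_subproof c (r : {posnum R}) (f : CpType p X E) :
  cutoff_fun c r%:num f \in Cp p.
Proof. by apply: (jet_Cp oX (cutoff_jetP c f (gt0 r))) => //. Qed.

Definition cutoff c (r : {posnum R}) (f : CpType p X E) : CpType p X E :=
  CpFun (cutoff_subproof c r f).

Lemma cutoffE c (r : {posnum R}) (f : CpType p X E) x :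
  cutoff c r f x =
    (phi (SigSub (mem_setT (r%:num^-1 *: (val x - c)))) : R) *: f x.
Proof.
rewrite -[f x]taylor0; congr (_ *: _).
by rewrite -[RHS]taylor0.
Qed.

(** Each derivative that falls on the rescaled bump costs a factor 1 / r; for
    r <= 1 the worst case is 1 / r^m. *)
Lemma cutoff_Dn_norm c (r : {posnum R}) (f : CpType p X E) (M B : R) (x : X) k :
  (k <= m)%N -> r%:num <= 1 -> 0 <= M ->
  (forall j z, (j <= m)%N -> `|Dn j phi z| <= M) ->
  (forall j, (j <= m)%N -> `|Dn j f x| <= B) ->
  `|Dn k (cutoff c r f) x| <= 2 ^+ m * (M * B) / r%:num ^+ m.
Proof.
move=> km r1 M0 hM hB.
have B0 : 0 <= B by rewrite (le_trans _ (hB 0 (leq0n m))).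
apply: (jet_Dn_norm oX (cutoff_jetP c f (gt0 r))) => // [|s sk].
  by rewrite mulr_ge0 ?invr_ge0 ?exprn_ge0// mulr_ge0// ?exprn_ge0// mulr_ge0.
apply: (@le_trans _ _ (2 ^+ size s * ((M / r%:num ^+ m) * B) * \prod_(y <- s) `|y|)).
  apply: leibniz_norm => t; rewrite sk => tk; last first.
    rewrite (le_trans (taylor_norm _ _ _))// ler_wpM2r ?prodr_ge0// hB//.
    exact: leq_trans km.
  have tm := leq_trans tk km.
  have /le_trans -> // :=
    taylor_norm phi (SigSub (mem_setT (r%:num^-1 *: (val x - c))))
      [seq r%:num^-1 *: v | v <- t].
  rewrite size_map prod_norm_scale mulrA ler_wpM2r ?prodr_ge0//.
  rewrite ler_pM ?exprn_ge0// ?hM// normfV gtr0_norm// exprVn.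
  rewrite lef_pV2 ?posrE ?exprn_gt0//.
  by rewrite ler_wiXn2l.
rewrite ler_wpM2r ?prodr_ge0// sk.
rewrite -!mulrA [_^-1 * B]mulrC ler_wpM2r//.
  by rewrite !mulr_ge0 // invr_ge0 exprn_ge0.
by rewrite ler_weXn2l// ler1n.
Qed.

End Cutoff.

(** * The seminorms of the space of C^p functions *)

Section LocalDerivatives.
Context {R : realType} {G E : normedModType R} {X : set G}.

Lemma Dn_near0 k (f : X -> E) (x : X) : open X ->
  (\forall z \near x, f z = 0) -> Dn k f x = 0.
Proof.
move=> oX; elim: k x => [|k IH] x fx.
  by apply: symmapP => v; exact: (nbhs_singleton fx).
apply: DnS; apply/is_frechetP => e e0.
rewrite -(nbhs_set_typeP _ _ oX).
apply: filterS (near_join fx) => z /IH hz w.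
rewrite valL0_val hz IH// !subrr normr0 mulr_ge0 ?prodr_ge0//.
by rewrite mulr_ge0// ltW.
Qed.

End LocalDerivatives.

Section Seminorms.
Context {R : realType} {G E : completeNormedModType R} {X : set G}.
Context {p : \bar int}.
Implicit Types (f g : CpType p X E) (K : set X).

Lemma rho_ubound K k f : compact K -> N_ p k ->
  has_ubound [set r | exists x j, [/\ K x, (j <= k)%N & r = `|Dn j f x|]].
Proof.
move=> cK pk.
have bD j : (j < k.+1)%N ->
    exists2 M : R, 0 <= M & forall x, K x -> `|Dn j f x| <= M.
  rewrite ltnS => jk; have pj : N_ p j by apply: (N_leq pk).
  have /asboolP/(_ j pj)[cD _] := Cp_valP f.
  have /compact_bounded[M [_ hM]] : compact (Dn j f @` K).
    by apply: continuous_compact => //; exact: continuous_subspaceT.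
  exists (`|M| + 1) => [|x Kx]; first by rewrite addr_ge0.
  by apply: (hM (`|M| + 1)); [rewrite ltr_pwDr// ler_norm|exists x].
suff [M hM] : exists M : R,
    forall j, (j < k.+1)%N -> forall x, K x -> `|Dn j f x| <= M.
  by exists M => _ [x [j [Kx jk ->]]]; exact: hM.
elim: k.+1 bD => [_|n IH bD]; first by exists 0.
have [M hM] := IH (fun j jn => bD j (ltnW jn)).
have [M' M'0 hM'] := bD n (ltnSn n).
exists (Num.max M M') => j; rewrite ltnS leq_eqVlt => /predU1P[->|jn] x Kx.
  by rewrite le_max hM' ?orbT.
by rewrite le_max hM.
Qed.

Lemma rho_ge K k f x j : compact K -> N_ p k -> K x -> (j <= k)%N ->
  `|Dn j f x| <= rho K k f.
Proof.
by move=> cK pk Kx jk; apply: ub_le_sup; [exact: rho_ubound|exists x, j].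
Qed.

Lemma rho_le K k f C : 0 <= C ->
  (forall x j, K x -> (j <= k)%N -> `|Dn j f x| <= C) -> rho K k f <= C.
Proof.
move=> C0 h; rewrite /rho; set S := [set r | _].
have [->|/set0P S0] := eqVneq S set0; first by rewrite sup0.
by apply: ge_sup => // _ [x [j [Kx jk ->]]]; exact: h.
Qed.

Lemma rho_ge0 K k f : compact K -> N_ p k -> 0 <= rho K k f.
Proof.
move=> cK pk; rewrite /rho; set S := [set r | _].
have [->|/set0P[_ [x [j [Kx jk _]]]]] := eqVneq S set0; first by rewrite sup0.
by rewrite (le_trans _ (rho_ge f cK pk Kx jk)).
Qed.

Lemma Dn_CpD k (a : R) f g : N_ p k ->
  Dn k (a *: f + g : CpType p X E) = a *: Dn k f + Dn k g.
Proof.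
move=> pk; have /asboolP/(_ k pk)[_ df] := Cp_valP f.
have /asboolP/(_ k pk)[_ dg] := Cp_valP g.
by rewrite -Dn_lin.
Qed.

Lemma Dn_Cp0 k x : N_ p k -> Dn k (0 : CpType p X E) x = 0.
Proof.
move=> pk; have := Dn_CpD (-1) 0 0 pk.
by rewrite scaler0 addr0 scaleN1r addNr => ->.
Qed.

Lemma Dn_CpZ k (a : R) f x : N_ p k ->
  Dn k (a *: f : CpType p X E) x = a *: Dn k f x.
Proof.
move=> pk; rewrite -[a *: f]addr0 Dn_CpD//.
by transitivity (a *: Dn k f x + Dn k (0 : CpType p X E) x); rewrite // Dn_Cp0// addr0.
Qed.

Lemma rho0 K k : N_ p k -> rho K k (0 : CpType p X E) = 0.
Proof.
move=> pk; apply/le_anti/andP; split.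
  apply: rho_le => // x j Kx jk; rewrite Dn_Cp0 ?normr0//.
  by apply: (N_leq pk).
rewrite /rho; set S := [set r | _].
have [->|/set0P S0] := eqVneq S set0; first by rewrite sup0.
have S1 : S 0.
  have [r [x [j [Kx jk _]]]] := S0.
  exists x, j; split=> //; rewrite Dn_Cp0 ?normr0//.
  by apply: (N_leq pk).
apply: ub_le_sup => //; exists 0 => _ [x [j [Kx jk ->]]].
rewrite Dn_Cp0 ?normr0//.
by apply: (N_leq pk).
Qed.

Lemma rho_ball_nbhs K k (e : R) : compact K -> N_ p k -> 0 < e ->
  nbhs (0 : CpType p X E) [set g : CpType p X E | rho K k g < e].
Proof.
move=> cK pk e0; set U := [set g | _].
exists U; split => //; last by rewrite /U/= rho0.
exists [set U]; last by rewrite bigcup_set1.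
move=> _ ->; exists [fset U]%fset; last by rewrite set_fset1 bigcap_set1.
move=> V /fset1P ->; apply/mem_set; exists K, k, 0, e; split=> //.
by apply/seteqP; split=> g /=; rewrite subr0.
Qed.

(** A subbasic ball of center f that contains 0 contains a ball of center 0,
    with the radius decreased by the seminorm of f; finitely many of them are
    merged by taking the union of the compact sets, and m as the common
    order. *)
Lemma nbhs0_rho m (A : set (CpType p X E)) :
  N_ p m -> (forall k, N_ p k -> (k <= m)%N) ->
  nbhs (0 : CpType p X E) A ->
  exists K (e : R), [/\ compact K, 0 < e & forall g, rho K m g < e -> A g].
Proof.
move=> pm mp [_ [[B BD <-] [U BU U0] UA]].
have [S SD SU] := BD _ BU.
have hS V : V \in S -> exists K (e : R),
    [/\ compact K, 0 < e & forall g, rho K m g < e -> V g].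
  move=> VS; have VV : V 0 by move: U0; rewrite -SU; apply.
  have /set_mem [K [k [f [e [cK pk e0 eV]]]]] := SD _ VS.
  move: VV; rewrite eV /= => f0.
  exists K, (e - rho K k (0 - f)).
  split; [exact: cK|by rewrite subr_gt0|move=> g gK].
  apply: le_lt_trans (_ : rho K k (0 - f) + rho K m g < e).
    apply: rho_le => [|x j Kx jk]; first by rewrite addr_ge0// rho_ge0.
    have pj : N_ p j by apply: (N_leq pk).
    have -> : g - f = 1 *: (0 - f) + g by rewrite scale1r sub0r addrC.
    rewrite Dn_CpD// scale1r (le_trans (ler_normD _ _))// lerD ?rho_ge//.
    by rewrite (leq_trans jk)// mp.
  by rewrite addrC -ltrBrDr.
have hs (s : seq (set (CpType p X E))) : {subset s <= S} ->
    exists K (e : R),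
      [/\ compact K, 0 < e & forall g, rho K m g < e -> forall V, V \in s -> V g].
  elim: s => [_|V s IH sS]; first by exists set0, 1; split=> //; exact: compact0.
  have [K [e [cK e0 h]]] := IH (fun W Ws => sS W (mem_behead (s := V :: s) Ws)).
  have [K' [e' [cK' e'0 h']]] := hS V (sS V (mem_head V s)).
  exists (K `|` K'), (Num.min e e').
  split; [exact: compactU|by rewrite lt_min e0|move=> g].
  have rU L : L `<=` K `|` K' -> compact L -> rho L m g <= rho (K `|` K') m g.
    move=> LK cL; have cU : compact (K `|` K') by exact: compactU.
    by apply: rho_le => [|x j /LK Kx jk]; [exact: rho_ge0|exact: rho_ge].
  rewrite lt_min => /andP[ge ge'] W; rewrite inE => /predU1P[->|].
    by apply: h'; apply: le_lt_trans ge'; apply: rU => // x; right.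
  by apply: h; apply: le_lt_trans ge; apply: rU => // x; left.
have [K [e [cK e0 h]]] := hs S (fun V h => h).
exists K, e; split; [exact: cK|exact: e0|move=> g gK; apply: UA; exists U => //].
suff Ug : U g by exact: Ug.
by rewrite -SU => V VS; exact: h.
Qed.

End Seminorms.

(** * Mean value and Taylor estimates *)

(** The path is constant beyond the ends of the segment, so that it is
    continuous on the whole line. *)
Lemma segment_lift {R : realType} {V : normedModType R} (Y : set V) (y : Y)
    (v : V) : (forall t : R, 0 <= t <= 1 -> Y (val y + t *: v)) ->
  exists2 g : R -> Y, continuous g &
    forall t, 0 <= t <= 1 -> val (g t) = val y + t *: v.
Proof.
move=> hY; pose cl (t : R) := Num.max 0 (Num.min 1 t).
have cl01 t : 0 <= cl t <= 1.
  by rewrite /cl le_max lexx /= ge_max ler01 ge_min lexx.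
pose g t : Y := SigSub (mem_set (hY (cl t) (cl01 t))).
exists g => [|t /andP[t0 t1]]; last first.
  by rewrite /= /cl (min_r t1) (max_r t0).
apply: (@continuous_comp_initial Y _ V set_val g) => t.
apply: cvgD; first exact: cvg_cst.
apply: cvgZr_tmp.
have ccl : {for t, continuous ((fun=> 0 : R^o) \max ((fun=> 1 : R^o) \min id))}.
  apply: continuous_max; first exact: cvg_cst.
  by apply: continuous_min; [exact: cvg_cst|exact: cvg_id].
exact: ccl.
Qed.

Section MeanValue.
Context {R : realType}.

(** No derivative is mentioned: u only has to grow at c with speed at most M,
    for every c. The supremum c of the t at which the bound (M + e) (t - a) holds
    satisfies the bound, and the local bound at c would push it beyond c if c
    were less than b. With M = 0, this says that a function with derivative
    zero is constant. *)
Lemma mean_value_norm (V : normedModType R) (u : R -> V) (a b M : R) : a <= b ->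
  (forall c, a <= c <= b -> forall e, 0 < e -> \forall t \near c,
     a <= t <= b -> `|u t - u c| <= (M + e) * `|t - c|) ->
  `|u b - u a| <= M * (b - a).
Proof.
move=> ab h.
suff he e : 0 < e -> `|u b - u a| <= (M + e) * (b - a).
  apply/ler_addgt0Pr => e e0.
  have d0 : 0 < b - a + 1 by rewrite ltr_wpDl// subr_ge0.
  rewrite (le_trans (he (e / (b - a + 1)) _)) ?divr_gt0// mulrDl lerD2l.
  by rewrite mulrAC ler_pdivrMr// ler_wpM2l ?(ltW e0)// lerDl.
move=> e0; set N := M + e.
pose S := [set t | a <= t <= b /\ `|u t - u a| <= N * (t - a)].
have Sa : S a by split; rewrite ?lexx ?ab// !subrr normr0 mulr0.
have hS : has_sup S by split; [exists a|exists b => t [/andP[]]].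
pose c := sup S.
have ac : a <= c by exact: (ub_le_sup hS.2).
have cb : c <= b by apply: ge_sup; [exists a|move=> t [/andP[]]].
have acb : a <= c <= b by rewrite ac.
have /nbhs_ballP[d /= d0 hd] := h c acb e e0.
have Sc : S c.
  split=> //; have [t St ct] := sup_adherent d0 hS.
  have tc : t <= c by exact: (ub_le_sup hS.2).
  have [tab tN] := St.
  have ht : `|u t - u c| <= N * `|t - c|.
    by apply: hd => //; rewrite /ball/= ger0_norm ?subr_ge0// ltrBlDr addrC -ltrBlDr.
  rewrite -[u c](subrK (u t)) -addrA (le_trans (ler_normD _ _))//.
  rewrite (_ : N * (c - a) = N * (c - t) + N * (t - a)) ?lerD//;
    last by rewrite -mulrDr addrA subrK.
  have ect : `|t - c| = c - t by rewrite distrC ger0_norm// subr_ge0.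
  by rewrite distrC -ect.
have [<-|nbc] := eqVneq c b; first exact: Sc.2.
have cb' : c < b by rewrite lt_neqAle nbc.
pose t := Num.min b (c + d / 2).
have ct : c < t by rewrite lt_min cb' ltrDl divr_gt0.
have tb : t <= b by rewrite ge_min lexx.
have tcd : t - c < d.
  rewrite ltrBlDr addrC (@le_lt_trans _ _ (c + d / 2))//.
    by rewrite ge_min lexx orbT.
  by rewrite ltrD2l ltr_pdivrMr// ltr_pMr// ltr1n.
have tab : a <= t <= b by rewrite tb (le_trans ac (ltW ct)).
have ht : `|u t - u c| <= N * `|t - c|.
  by apply: hd => //; rewrite /ball/= distrC ger0_norm// subr_ge0 ltW.
suff /(ub_le_sup hS.2) : S t by rewrite leNgt ct.
split=> //; rewrite -[u t](subrK (u c)) -addrA (le_trans (ler_normD _ _))//.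
rewrite (_ : N * (t - a) = N * (t - c) + N * (c - a)) ?lerD//;
  last by rewrite -mulrDr addrA subrK.
  by move: ht; rewrite [X in _ * X]ger0_norm// subr_ge0 ltW.
exact: Sc.2.
Qed.

Lemma near_line (V : normedModType R) (x v : V) (c : R) (Q : set V) :
  (\forall z \near x + c *: v, Q z) -> \forall t \near c, Q (x + t *: v).
Proof.
suff cu : (fun t => x + t *: v) @ nbhs c --> x + c *: v by exact: cu.
by apply: cvgD; [exact: cvg_cst|apply: cvgZr_tmp; exact: cvg_id].
Qed.

Lemma mform_head0 (G E : normedModType R) (a : seq G -> E) s :
  mform a -> a (0 :: s) = 0.
Proof.
move=> ma; have := mform_lin ma s (-1) 0 0.
by rewrite addr0 scaleN1r oppr0 scaleN1r addNr.
Qed.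

Lemma mform_headZ (G E : normedModType R) (a : seq G -> E) (r : R) x s :
  mform a -> a (r *: x :: s) = r *: a (x :: s).
Proof.
by move=> ma; have := mform_lin ma s r x 0; rewrite addr0 mform_head0// addr0.
Qed.

(** Taylor's formula at a point x where all derivatives up to order m vanish.
    The bound M on the derivative of order m.+1 descends to each lower order by the
    mean value inequality on the segment, as the increment v is already in the
    list and t ranges over the unit interval. *)
Lemma jet_flat_bound (G E : normedModType R) (X : set G) m J (x v : G) (M : R) :
  jet m.+1 X (J : G -> seq G -> E) ->
  (forall t, 0 <= t <= 1 -> X (x + t *: v)) ->
  (forall j, (j <= m)%N -> J x (nseq j v) = 0) ->
  (forall t, 0 <= t <= 1 -> `|J (x + t *: v) (nseq m.+1 v)| <= M) ->
  `|J (x + v) [::]| <= M.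
Proof.
move=> jJ Xs J0 JM.
have M0 : 0 <= M by rewrite (le_trans _ (JM 0 _))// lexx ler01.
suff H j : (j <= m.+1)%N -> forall t, 0 <= t <= 1 ->
    `|J (x + t *: v) (nseq (m.+1 - j) v)| <= M.
  by have := H m.+1 (leqnn _) 1; rewrite subnn scale1r; apply; rewrite ler01 lexx.
elim: j => [_|j IH jm t /andP[t0 t1]]; first by rewrite subn0.
set i := (m.+1 - j.+1)%N.
have ij : (m.+1 - j = i.+1)%N by rewrite /i subSS subSn.
have im : (i < m.+1)%N by rewrite /i subSS ltnS leq_subr.
pose u s := J (x + s *: v) (nseq i v).
have u0 : u 0 = 0 by rewrite /u scale0r addr0 J0.
suff : `|u t - u 0| <= M * (t - 0).
  by rewrite u0 !subr0 => /le_trans-> //; rewrite ler_piMr.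
apply: mean_value_norm => // c /andP[c0 ct] e e0.
have c01 : 0 <= c <= 1 by rewrite c0 (le_trans ct).
pose P := `|v| * \prod_(y <- nseq i v) `|y|.
have P0 : 0 <= P by rewrite mulr_ge0// prodr_ge0.
have e1 : 0 < e / (P + 1) by rewrite divr_gt0// ltr_wpDl.
apply: filterS (near_line (jet_diff jJ (Xs c c01) im e1)) => s hs _.
have := hs (nseq i v) (size_nseq _ _).
rewrite (_ : x + s *: v - (x + c *: v) = (s - c) *: v); last first.
  by rewrite opprD addrACA subrr add0r -scalerBl.
rewrite (mform_headZ _ _ _ (jet_mform jJ (Xs c c01))) normrZ => hs'.
rewrite -[u s - u c](subrK ((s - c) *: J (x + c *: v) (v :: nseq i v))).
rewrite (le_trans (ler_normD _ _))// addrC mulrDl lerD//.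
  rewrite normrZ mulrC ler_wpM2r//.
  by have := IH (ltnW jm) c c01; rewrite ij.
rewrite (le_trans hs')//.
rewrite (_ : _ * _ = e * `|s - c| * (P / (P + 1))); last by rewrite /P; ring.
by rewrite ler_piMr ?mulr_ge0 ?(ltW e0)// ler_pdivrMr ?ltr_wpDl// mul1r lerDl.
Qed.

End MeanValue.

(** * The compactification *)

Section Embedding.
Context {R : realType} {G E : completeNormedModType R} {p : \bar int} {X : set G}.

(** Compactness of C is what keeps its image away from the point at infinity. *)
Lemma opc_closed_some {S : topologicalType} (C : set S) :
  compact C -> closed C ->
  closed (Some @` C : set (one_point_compactification S)).
Proof.
move=> kC cC; rewrite -openC openE => -[s|] sC.
  have nCs : nbhs s (~` C).
    apply: open_nbhs_nbhs; split; first exact: closed_openC.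
    by move=> Cs; apply: sC; exists s.
  suff : nbhs (Some s : one_point_compactification S) (~` (Some @` C)) by [].
  have := one_point_compactification_some_nbhs _ _ nCs.
  apply: (@filterS _ _ (nbhs_filter (Some s : one_point_compactification S))).
  by move=> _ [t Ct <-]; move=> [t' Ct' [tt']]; apply: Ct; rewrite -tt'.
exists C => // _ [[t Ct <-]|-> []//].
by move=> [t' Ct' [tt']]; apply: Ct; rewrite -tt'.
Qed.

Lemma AX_coord_continuous (psi : CpType p X R^o) :
  continuous (fun u : AX p X => (val u : cube p X) psi).
Proof.
move=> u.
have h1 : continuous (set_val : AX p X -> cube p X) by exact: initial_continuous.
have h2 := @proj_continuous (CpType p X R^o)
  (fun=> one_point_compactification R) psi (val u).
exact: (continuous_comp (h1 u) h2).
Qed.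

Lemma Cp_continuous (f : CpType p X E) : open X -> N_ p 0 -> continuous f.
Proof.
move=> oX p0 x; apply/(@cvgrPdist_le _ _ _ _ (nbhs_filter x)) => e e0.
have := jet_cont (taylor_jet oX (Cp_valP f) p0) (set_valP x) (leqnn 0) e0.
rewrite -(nbhs_set_typeP _ _ oX).
apply: (@filterS _ _ (nbhs_filter x)) => z /(_ [::] erefl).
by rewrite big_nil mulr1 !taylor0 distrC.
Qed.

Lemma embX_AX (x : X) : embX p x \in AX p X.
Proof. by apply/mem_set/subset_closure; exists x. Qed.

Definition toAX (x : X) : AX p X := SigSub (embX_AX x).

Lemma toAX_continuous :
  (forall psi : CpType p X R^o, continuous psi) -> continuous toAX.
Proof.
move=> cpsi.
suff cE : continuous (embX p : X -> cube p X).
  by move=> x; apply: (@continuous_comp_initial (AX p X) X (cube p X) set_val toAX).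
move=> x; have FF : Filter (embX p z @[z --> x] : set_system (cube p X)).
  by apply: (@fmap_filter _ _ (embX p)); exact: nbhs_filter.
apply/cvg_sup => psi.
apply: (@continuous_comp_initial _ X _
  (fun f : CpType p X R^o -> one_point_compactification R => f psi) (embX p)).
move=> z.
exact: (continuous_comp (cpsi psi z)
  (@one_point_compactification_some_continuous R (psi z))).
Qed.

End Embedding.

(** * Support points *)

Section CutoffValues.
Context {R : realType} {G E : completeNormedModType R} {X : set G}.
Context {p : \bar int} {m : nat}.
Hypotheses (oX : open X) (pm : N_ p m) (mp : forall k, N_ p k -> (k <= m)%N).
Variable phi : CpType p [set: G] R^o.
Hypotheses (phi1 : forall x, `|val x| <= 2^-1 -> phi x = 1)
  (phi0 : forall x, 1 <= `|val x| -> phi x = 0).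

Local Notation cutoff := (cutoff oX pm mp phi).

Lemma cutoff_inner c (r : {posnum R}) (f : CpType p X E) x :
  `|val x - c| <= r%:num / 2 -> cutoff c r f x = f x.
Proof.
move=> xc; rewrite cutoffE phi1 ?scale1r//=.
by rewrite normrZ normfV gtr0_norm// ler_pdivrMl.
Qed.

Lemma cutoff_outer c (r : {posnum R}) (f : CpType p X E) x :
  r%:num <= `|val x - c| -> cutoff c r f x = 0.
Proof.
move=> xc; rewrite cutoffE phi0 ?scale0r//=.
by rewrite normrZ normfV gtr0_norm// ler_pdivlMl// mulr1.
Qed.

End CutoffValues.

Section SupportPoint.
Context {R : realType} {G H E F : completeNormedModType R}.
Context {X : set G} {Y : set H} {p q : \bar int} {m : nat}.
Context {T : {linear CpType p X E -> CpType q Y F}}.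
Hypotheses (oX : open X) (pm : N_ p m) (mp : forall k, N_ p k -> (k <= m)%N).
Hypotheses (sepT : separating T) (cT : continuous T).

Lemma T_seminorm_bound (L : set Y) j : compact L -> N_ q j ->
  exists K (e : R), [/\ compact K, 0 < e &
    forall f, rho K m f < e -> rho L j (T f) < 1].
Proof.
move=> cL qj; apply: (nbhs0_rho (A := [set f | rho L j (T f) < 1])) => //.
have := @rho_ball_nbhs R H F Y q L j 1 cL qj ltr01.
by rewrite -(linear0 T) => /cT.
Qed.

Lemma T_eval_Z (a : R) f y : T (a *: f) y = a *: T f y.
Proof. by rewrite linearZ. Qed.

Lemma T_eval_B f g y : T (f - g) y = T f y - T g y.
Proof. by rewrite linearB. Qed.

(** The description of the support map within X, without the compactification. *)
Definition support_pt (y : Y) (x : X) : Prop := forall r : R, 0 < r ->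
  exists2 g : CpType p X E, T g y != 0 & forall z, g z != 0 -> `|val z - val x| < r.

(** A function g localized near x with Tg(y) nonzero is disjoint from f. *)
Lemma support_pt_local y x (r : R) (f : CpType p X E) : support_pt y x -> 0 < r ->
  (forall z, `|val z - val x| < r -> f z = 0) -> T f y = 0.
Proof.
move=> sx r0 f0; have [g gy gr] := sx r r0.
have [//|gy0] : T f y = 0 \/ T g y = 0.
  apply: sepT => z; have [->|/gr/f0->] := eqVneq (g z) 0; by [right|left].
by rewrite gy0 eqxx in gy.
Qed.

(** The seminorm that controls T vanishes on all multiples of f, so that all
    multiples of Tf(y) have norm less than 1. *)
Lemma T_flat y : N_ q 0 -> exists2 K, compact K & forall f : CpType p X E,
  (forall x j, K x -> (j <= m)%N -> Dn j f x = 0) -> T f y = 0.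
Proof.
move=> q0; have [K [e [cK e0 h]]] := T_seminorm_bound (@compact_set1 _ y) q0.
exists K => // f fK; apply/eqP/negP => /negP Tf0.
pose a := `|T f y|^-1.
have : rho K m (a *: f) < e.
  apply: le_lt_trans e0; apply: rho_le => // x j Kx jm.
  rewrite Dn_CpZ ?fK ?scaler0 ?normr0//.
  by apply: (N_leq pm).
move=> /h; rewrite ltNge => /negP; apply.
have := rho_ge (T (a *: f)) (@compact_set1 _ y) q0 (erefl y) (leqnn 0).
apply: le_trans; apply: le_trans (_ : `|T (a *: f) y| <= _).
  by rewrite T_eval_Z normrZ normfV normr_id mulVf// normr_eq0.
have := symmap_norm_apply (Dn 0 (T (a *: f)) y) (fun=> 0).
by rewrite big_ord0 mulr1.
Qed.

(** Otherwise each x has a ball such that Tf(y) = 0 for all f supported in it.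
    The half balls cover the compact set K of T_flat; subtracting from f its
    cutoffs to these balls one after the other does not change Tf(y), and
    leaves a function that vanishes near K, hence Tf(y) = 0 for all f. *)
Lemma support_pt_exists y : N_ q 0 -> has_bump G p -> nowhere_trivial T ->
  exists x, support_pt y x.
Proof.
move=> q0 [phi [phi1 phi0 _]] /(_ y)[f Tf0].
apply: contrapT => /forallNP nx.
have ex_r : forall x : X, exists r : {posnum R}, forall g : CpType p X E,
    (forall z, g z != 0 -> `|val z - val x| < r%:num) -> T g y = 0.
  move=> x; have /existsNP[r /not_implyP[r0 hr]] := nx x.
  exists (PosNum r0) => g gr; apply/eqP/negP => /negP gy.
  by apply: hr; exists g.
have [r hr] := choice ex_r.
have [K cK hK] := T_flat y q0.
pose U (x : X) := [set u : G | `|u - val x| < (r x)%:num / 2].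
have oU x : open (U x).
  have cd : continuous (fun u : G => `|u - val x|).
    by move=> u; apply: cvg_norm; apply: cvgB; [exact: cvg_id|exact: cvg_cst].
  have od : open [set d : R | d < (r x)%:num / 2] by exact: open_lt.
  exact: (open_comp (fun u _ => cd u) od).
(* the covering property of compact sets is used in G, which is nonempty *)
have : compact ((val : X -> G) @` K).
  apply: continuous_compact => //; apply: continuous_subspaceT.
  exact: (initial_continuous (f := @set_val _ X)).
rewrite compact_cover => /(_ X setT U (fun x _ => oU x)).
case=> [_ [x _ <-]|D _ KD].
  by exists x => //; rewrite /U/= subrr normr0 divr_gt0.
have clear_on (s : seq X) : exists2 g : CpType p X E, T g y = T f y &
    forall x, x \in s -> forall z : X, U x (val z) -> g z = 0.
  elim: s => [|x s [g Tg g0]]; first by exists f.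
  exists (g - cutoff oX pm mp phi (val x) (r x) g).
    rewrite T_eval_B (hr x (cutoff _ _ _ _ _ _ _)) ?subr0// => z.
    by rewrite ltNge; apply: contraNN => xz; rewrite cutoff_outer.
  have E0 z : (g - cutoff oX pm mp phi (val x) (r x) g) z =
    g z - cutoff oX pm mp phi (val x) (r x) g z by [].
  move=> x'; rewrite inE => /predU1P[->|x's] z Uz; rewrite E0.
    by rewrite cutoff_inner ?subrr// ltW.
  by rewrite cutoffE (g0 x')// scaler0 subr0.
have [g Tg g0] := clear_on (enum_fset D).
move/eqP: Tf0; rewrite -Tg; apply; apply: hK => x j Kx jm.
apply: Dn_near0 => //; have [x' x'D Ux'] := KD _ (imageP val Kx).
have : \forall z \near val x, U x' z by apply: open_nbhs_nbhs.
rewrite -(nbhs_set_typeP _ _ oX).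
by apply: (@filterS _ _ (nbhs_filter x)) => z; exact: g0.
Qed.

End SupportPoint.

(** * Support points and the support map *)

Section SupportMapPoint.
Context {R : realType} {G H E F : completeNormedModType R}.
Context {X : set G} {Y : set H} {p q : \bar int}.
Context {T : {linear CpType p X E -> CpType q Y F}}.
Hypotheses (oX : open X) (p0 : N_ p 0) (sepT : separating T).

(** A point of the compactification is separated from x by a single coordinate
    psi. The tube over an interval restricts that coordinate; it is open or
    closed with the interval, and this replaces the regularity of the
    compactification. *)
Let tube (psi : CpType p X R^o) (D : set R) : set (AX p X) :=
  [set v | (Some @` D) ((val v : cube p X) psi)].

Let tube_closed psi (a b : R) : closed (tube psi `[a, b]).
Proof.
apply: (closed_comp (f := fun u : AX p X => (val u : cube p X) psi)).
  by move=> u _; exact: AX_coord_continuous.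
by apply: opc_closed_some; [exact: segment_compact|exact: itv_closed].
Qed.

Let tube_open psi (a b : R) : open (tube psi `]a, b[).
Proof.
apply: (open_comp (f := fun u : AX p X => (val u : cube p X) psi)).
  by move=> u _; exact: AX_coord_continuous.
by apply: one_point_compactification_open_some; exact: itv_open.
Qed.

(** A point u other than x has some coordinate different from psi(x). Functions
    supported near x with Tf(y) nonzero have their closed support in a tube
    around psi(x), whose closure misses u. Conversely, if f witnesses that
    U is in the family, then f cannot vanish near x, so that U meets every
    neighborhood of x. *)
Lemma support_pt_bigcap y x : support_pt (T := T) y x ->
  \bigcap_(U in Ofam T y) closure U = [set u : AX p X | val u = embX p x].
Proof.
move=> sx; apply/seteqP; split=> [u Uu|u ux U [oU [f [Tf fU]]] B].
  apply: contrapT => /eqP ux.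
  have [psi upsi] : exists psi, (val u : cube p X) psi != Some (psi x).
    apply: contrapT => /forallNP h; move/eqP: ux; apply; apply/funext => psi.
    by have /negP/negPn/eqP := h psi.
  set a := psi x in upsi.
  have [d d0 nud] : exists2 d : R, 0 < d &
      ~ (Some @` `[a - d, a + d]) ((val u : cube p X) psi).
    case: ((val u : cube p X) psi) upsi => [b|] ba.
      have ab : 0 < `|a - b|.
        by rewrite normr_gt0 subr_eq0; apply: contra ba => /eqP->.
      exists (`|a - b| / 2); first by rewrite divr_gt0.
      move=> [b' + bb']; rewrite (Some_inj bb') /= in_itv /= -ler_distlC.
      by rewrite leNgt ltr_pdivrMr// ltr_pMr// ltr1n.
    by exists 1 => // -[].
  apply: nud.
  have : closure (tube psi `]a - d, a + d[) `<=` tube psi `[a - d, a + d].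
    rewrite [X in _ `<=` X](closure_id _).1//; apply: closureS => v [b bd bE].
    by exists b => //; apply: subset_itv_oo_cc.
  apply; apply: Uu; split; first exact: tube_open.
  have [r r0 hr] : exists2 r : R, 0 < r & forall z : X, `|val z - val x| < r ->
      `]a - d / 2, a + d / 2[%classic (psi z).
    apply: (nbhs_set_type_ball
      (A := [set z | `]a - d / 2, a + d / 2[%classic (psi z)])).
    have : \forall b \near psi x, `]a - d / 2, a + d / 2[%classic b.
      apply: open_nbhs_nbhs; split; first exact: itv_open.
      by rewrite /= in_itv /= gtrBl ltrDl divr_gt0.
    exact: (Cp_continuous (f := psi) oX p0).
  have [f Tf fr] := sx r r0; exists f; split => //.
  have : Cbar f `<=` tube psi `[a - d / 2, a + d / 2].
    rewrite [X in _ `<=` X](closure_id _).1//; apply: closureS => v [z fz vz].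
    rewrite /tube /= vz; exists (psi z) => //.
    by apply: subset_itv_oo_cc; apply: hr; exact: fr.
  move=> /subset_trans; apply => v [b bd bE]; exists b => //.
  move: bd; rewrite /= !in_itv /= => /andP[b1 b2].
  have dd : d / 2 < d by rewrite ltr_pdivrMr// ltr_pMr// ltr1n.
  by rewrite (lt_le_trans _ b1) ?ltrD2l ?ltrN2//= (le_lt_trans b2)// ltrD2l.
have uE : u = toAX x by apply/val_inj.
rewrite {}uE => nB.
have /nbhs_set_type_ball[r r0 hr] : nbhs x (toAX (p := p) @^-1` B).
  apply: (toAX_continuous (X := X) _ nB) => psi; exact: (Cp_continuous oX p0).
apply: contrapT => UB; move/eqP: Tf; apply.
apply: (support_pt_local sepT sx r0) => z zx.
apply/eqP/negP => /negP fz; apply: UB; exists (toAX z); split; last exact: hr.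
by apply: fU; apply: subset_closure; exists z.
Qed.

End SupportMapPoint.

(** * The support map is locally constant *)

Section LocallyConstant.
Context {R : realType} {G H E F : completeNormedModType R}.
Context {X : set G} {Y : set H} {p q : \bar int} {m : nat}.
Context {T : {linear CpType p X E -> CpType q Y F}}.
Hypotheses (oX : open X) (oY : open Y).
Hypotheses (pm : N_ p m) (mp : forall k, N_ p k -> (k <= m)%N).
Hypotheses (qm : N_ q m.+1).
Hypotheses (sepT : separating T) (cT : continuous T).

Let p0 : N_ p 0.
Proof. by apply: (N_leq pm). Qed.

Let q0 : N_ q 0.
Proof. by apply: (N_leq qm). Qed.

(** Some k supported away from g has Tk(y) nonzero, and this persists near y; Tg
    must vanish there because T is separating. *)
Lemma T_vanish_near (y : Y) (x : X) c (r : R) (g : CpType p X E) :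
  support_pt (T := T) y x -> r < `|val x - c| ->
  (forall z, r <= `|val z - c| -> g z = 0) ->
  \forall z \near y, T g z = 0.
Proof.
move=> sx rx g0.
have [k Tk kr] := sx (`|val x - c| - r) (etrans (subr_gt0 _ _) rx).
have cTk := Cp_continuous (f := T k) oY q0 (x := y).
have Tk0 : \forall z \near y, T k z != 0.
  exact: (@cvgr_neq0 _ _ _ (nbhs y) (nbhs_filter y) (T k) _ cTk).
apply: (@filterS _ _ (nbhs_filter y)) Tk0 => z Tkz.
suff [//|Tk0] : T g z = 0 \/ T k z = 0 by rewrite Tk0 eqxx in Tkz.
apply: sepT => z'; have [rz|rz] := leP r `|val z' - c|; first by left; exact: g0.
right; apply/eqP/negP => /negP /kr.
rewrite ltNge => /negP; apply.
rewrite lerBlDr (le_trans (ler_distD (val z') _ _))// distrC lerD// ltW//.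
Qed.

Lemma rho_sup_bound (K : set X) (f : CpType p X E) : compact K ->
  exists2 B : R, 0 < B & forall x j, K x -> (j <= m)%N -> `|Dn j f x| <= B.
Proof.
move=> cK; exists (rho K m f + 1); first by rewrite ltr_wpDl// rho_ge0.
by move=> x j Kx jm; rewrite (le_trans (rho_ge f cK pm Kx jm))// lerDl.
Qed.

Lemma has_bump_bound (phi : CpType p [set: G] R^o) :
  (forall k, N_ p k -> has_ubound (range (fun x => `|Dn k phi x|))) ->
  exists2 M : R, 0 < M & forall j z, (j <= m)%N -> `|Dn j phi z| <= M.
Proof.
move=> hub.
suff [M M0 hM] : exists2 M : R, 0 < M &
    forall j, (j < m.+1)%N -> forall z, `|Dn j phi z| <= M.
  by exists M => // j z jm; exact: hM.
have hub' k : (k < m.+1)%N -> has_ubound (range (fun x => `|Dn k phi x|)).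
  by move=> km; apply: hub; apply: (N_leq pm).
elim: m.+1 hub' => [_|n IH hub']; first by exists 1.
have [M M0 hM] := IH (fun k kn => hub' k (ltnW kn)).
have [M' hM'] := hub' n (ltnSn n).
exists (Num.max M M'); first by rewrite lt_max M0.
move=> j; rewrite ltnS leq_eqVlt => /predU1P[->|jn] z; last by rewrite le_max hM.
by rewrite le_max hM' ?orbT//; exists z.
Qed.

Variable h : Y -> X.
Hypothesis hP : forall y, support_pt (T := T) y (h y).
Variables (phi : CpType p [set: G] R^o) (M : R).
Hypotheses (phi1 : forall x, `|val x| <= 2^-1 -> phi x = 1)
  (phi0 : forall x, 1 <= `|val x| -> phi x = 0)
  (M0 : 0 < M) (hM : forall j z, (j <= m)%N -> `|Dn j phi z| <= M).

Local Notation cutoff := (cutoff oX pm mp phi).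

(** The key estimate: if h(y') is further than r from h(y), then Tf(y) is
    O(r^-m |y - y'|^(m+1)). *)
Lemma T_escape_bound (f : CpType p X E) (K : set X) (B e : R) (r : {posnum R})
    (y y' : Y) (L : set Y) :
  compact K -> 0 < B -> (forall x j, K x -> (j <= m)%N -> `|Dn j f x| <= B) ->
  0 < e -> compact L ->
  (forall g, rho K m g < e -> rho L m.+1 (T g) < 1) ->
  (forall t, 0 <= t <= 1 ->
    exists2 z, L z & val z = val y' + t *: (val y - val y')) ->
  r%:num <= 1 -> r%:num < `|val (h y') - val (h y)| ->
  e * r%:num ^+ m / (2 * (2 ^+ m * (M * B))) * `|T f y|
    <= `|val y - val y'| ^+ m.+1.
Proof.
move=> cK B0 hB e0 cL hT seg r1 hyy'.
pose C := 2 ^+ m * (M * B); have C0 : 0 < C by rewrite !mulr_gt0// ?exprn_gt0.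
(* a normalizes the cutoff: its seminorm becomes at most e / 2 *)
pose a := e * r%:num ^+ m / (2 * C).
have a0 : 0 < a by rewrite divr_gt0 ?mulr_gt0// exprn_gt0.
pose fr := cutoff (val (h y)) r f; pose g := a *: fr.
have Tfr : T fr y = T f y.
  apply/eqP; rewrite eq_sym -subr_eq0 -T_eval_B; apply/eqP.
  have r2 : 0 < r%:num / 2 by rewrite divr_gt0.
  apply: (support_pt_local sepT (hP y) r2) => z zr.
  have -> : (f - fr) z = f z - fr z by [].
  by rewrite /fr cutoff_inner ?subrr// ltW.
have rg : rho K m g < e.
  apply: (@le_lt_trans _ _ (e / 2)); last by rewrite ltr_pdivrMr// ltr_pMr// ltr1n.
  apply: rho_le => [|x j Kx jm]; first by rewrite divr_ge0// ltW.
  have pj : N_ p j by apply: (N_leq pm).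
  rewrite /g Dn_CpZ// normrZ (gtr0_norm a0).
  have fC : `|Dn j fr x| <= C / r%:num ^+ m.
    by apply: cutoff_Dn_norm => // [|i im]; [exact: ltW|exact: hB].
  rewrite (le_trans (ler_wpM2l (ltW a0) fC))// /a le_eqVlt; apply/orP; left.
  by apply/eqP; field; rewrite !gt_eqF ?exprn_gt0//.
have gL z : L z -> `|Dn m.+1 (T g) z| <= 1.
  by move=> Lz; rewrite (le_trans (rho_ge (T g) cL qm Lz (leqnn _)))// ltW// hT.
have g0 : \forall z \near y', T g z = 0.
  apply: (T_vanish_near (hP y') hyy') => z rz.
  have -> : g z = a *: fr z by [].
  by rewrite /fr cutoff_outer// scaler0.
have -> : e * r%:num ^+ m / (2 * C) * `|T f y| = `|T g y|.
  by rewrite /g T_eval_Z normrZ (gtr0_norm a0) Tfr.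
pose v := val y - val y'.
have yE : val y = val y' + v by rewrite addrC subrK.
rewrite -/v -[T g y]taylor0 [in taylor _ _ _]yE.
apply: (jet_flat_bound (taylor_jet oY (Cp_valP (T g)) qm)) => [t t01|j jm|t t01].
- by have [z _ <-] := seg t t01; exact: set_valP.
- apply/eqP; rewrite -normr_le0 (le_trans (taylor_norm _ _ _))//.
  by rewrite size_nseq Dn_near0// normr0 mul0r.
have [z Lz <-] := seg t t01.
rewrite (le_trans (taylor_norm _ _ _))// size_nseq big_nseq.
rewrite iter_mulr_1.
by rewrite ler_piMl ?exprn_ge0// gL.
Qed.

(** Along a segment issued from y on which |Tf| > a > 0, the key estimate with
    r = e |t - c| bounds C e^m a below by |t - c| |v|^(m+1), up to a common
    factor |t - c|^m. This fails for t close to c, so h has speed zero. *)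
Lemma support_locally_constant (y : Y) : nowhere_trivial T ->
  \forall z \near y, h z = h y.
Proof.
move=> /(_ y)[f Tf].
pose a := `|T f y| / 2.
have a0 : 0 < a by rewrite divr_gt0// normr_gt0.
have cTf := Cp_continuous (f := T f) oY q0 (x := y).
have Tfa : \forall z \near y, a < `|T f z|.
  apply: (@cvgr_gt _ _ _ (nbhs_filter y) _ _ (cvg_norm cTf)).
  by rewrite ltr_pdivrMr// ltr_pMr ?normr_gt0// ltr1n.
have [d1 d10 hd1] := nbhs_set_type_ball Tfa.
have /nbhs_ballP[d2 d20 hd2] : nbhs (val y) Y.
  by apply: open_nbhs_nbhs; split => //; exact: set_valP.
have [d d0 [dd1 dd2]] : exists2 d, 0 < d & d <= d1 /\ d <= d2.
  by exists (Num.min d1 d2); [rewrite lt_min d10|rewrite !ge_min !lexx orbT].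
suff hz (z : Y) : `|val z - val y| < d -> h z = h y.
  have : nbhs y [set z : Y | `|val z - val y| < d].
    have : \forall u \near val y, `|u - val y| < d.
      by apply/nbhs_ballP; exists d => // u; rewrite -ball_normE /= distrC.
    by rewrite -(nbhs_set_typeP _ _ oY).
  by apply: (@filterS _ _ (nbhs_filter y)) => z; exact: hz.
move=> zd; pose v := val z - val y.
have dv (t : R) : 0 <= t <= 1 -> `|t *: v| < d.
  move=> /andP[t0 t1]; rewrite normrZ ger0_norm// (le_lt_trans _ zd)//.
  by rewrite ler_piMl.
have [g cg gE] : exists2 g : R -> Y, continuous g &
    forall t, 0 <= t <= 1 -> val (g t) = val y + t *: v.
  apply: segment_lift => t /dv td; apply: hd2.
  by rewrite -ball_normE /= opprD addrA subrr add0r normrN (lt_le_trans td).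
have ag t : 0 <= t <= 1 -> a < `|T f (g t)|.
  move=> t01; apply: hd1; rewrite gE// addrAC subrr add0r.
  exact: lt_le_trans (dv t t01) dd1.
pose L := g @` `[0, 1].
have cL : compact L.
  apply: continuous_compact; last exact: segment_compact.
  exact: continuous_subspaceT.
have g0 : g 0 = y by apply/val_inj; rewrite gE ?scale0r ?addr0 ?lexx ?ler01.
have g1 : g 1 = z.
  by apply/val_inj; rewrite gE ?scale1r ?lexx ?ler01// addrC subrK.
rewrite -g0 -g1; apply/val_inj/eqP; rewrite -subr_eq0 -normr_le0.
rewrite -[leRHS](mul0r (1 - 0)).
apply: (mean_value_norm (u := fun t => val (h (g t)))) => // c c01 e e0.
have [K [b [cK b0 hT]]] := T_seminorm_bound pm mp cT cL qm.
have [B B0 hB] := rho_sup_bound f cK.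
pose C := b / (2 * (2 ^+ m * (M * B))).
have C0 : 0 < C by rewrite divr_gt0 ?mulr_gt0 ?exprn_gt0.
pose D := C * e ^+ m * a / (`|v| ^+ m.+1 + 1).
have v1 : 0 < `|v| ^+ m.+1 + 1 by rewrite ltr_wpDl// exprn_ge0.
have D0 : 0 < D.
  by apply: divr_gt0 => //; do 2 apply: mulr_gt0 => //; exact: exprn_gt0.
have near_c : \forall t \near c, `|t - c| < Num.min D e^-1.
  apply/nbhs_ballP; exists (Num.min D e^-1); last first.
    by move=> t; rewrite -ball_normE /= distrC.
  by rewrite /= lt_min D0 invr_gt0.
apply: filterS near_c => t; rewrite lt_min add0r => /andP[tD te] t01.
rewrite leNgt; apply/negP => ht.
have tc : 0 < `|t - c|.
  rewrite normr_gt0 subr_eq0; apply/eqP => tc.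
  by move: ht; rewrite tc !subrr !normr0 mulr0 ltxx.
have r0 : 0 < e * `|t - c| by rewrite mulr_gt0.
have r1 : e * `|t - c| <= 1 by rewrite mulrC -ler_pdivlMr// mul1r ltW.
have gtc : val (g c) - val (g t) = (c - t) *: v.
  by rewrite !gE// opprD addrACA subrr add0r -scalerBl.
have seg s : 0 <= s <= 1 -> exists2 w, L w &
    val w = val (g t) + s *: (val (g c) - val (g t)).
  move=> /andP[s0 s1]; pose w := t + s * (c - t).
  have w01 : 0 <= w <= 1.
    move: t01 c01 => /andP[t0 t1] /andP[c0 c1].
    rewrite (_ : w = (1 - s) * t + s * c); last by rewrite /w; ring.
    have s1' : 0 <= 1 - s by rewrite subr_ge0.
    rewrite addr_ge0 ?mulr_ge0//= -[leRHS](subrK s) lerD//.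
      by rewrite ler_piMr.
    by rewrite ler_piMr.
  exists (g w); first by exists w => //=; rewrite in_itv.
  by rewrite gtc !gE// scalerA -addrA -scalerDl.
have := T_escape_bound (r := PosNum r0) cK B0 hB b0 cL hT seg r1 ht.
rewrite gtc normrZ /= (distrC c) leNgt => /negP; apply.
rewrite (_ : b * _ / _ = C * (e * `|t - c|) ^+ m); last by rewrite /C mulrAC.
apply: (@lt_le_trans _ _ (C * (e * `|t - c|) ^+ m * a)); last first.
  by rewrite ler_wpM2l ?(ltW (ag _ _))// mulr_ge0 ?(ltW C0)// exprn_ge0// ltW.
rewrite (_ : C * _ * a = `|t - c| ^+ m * (C * e ^+ m * a)); last first.
  by rewrite exprMn; ring.
rewrite exprMn exprS.
rewrite -mulrA mulrCA ltr_pM2l ?exprn_gt0//.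
rewrite (_ : C * e ^+ m * a = D * (`|v| ^+ m.+1 + 1)); last by rewrite divfK ?gt_eqF.
apply: (@le_lt_trans _ _ (`|t - c| * (`|v| ^+ m.+1 + 1))).
  by rewrite ler_wpM2l// lerDl.
by rewrite ltr_pM2r.
Qed.

End LocallyConstant.

(** * Partition into level sets *)

Lemma finite_smoothness (p q : \bar int) : (1 <= p)%E -> (p < q)%E ->
  exists m, [/\ N_ p m, forall k, N_ p k -> (k <= m)%N & N_ q m.+1].
Proof.
case: p => [[m|m]| |] //; last by case: q.
move=> _ pq; exists m; split; first by rewrite /N_ /=.
  by move=> k; rewrite /N_ /= lee_fin lez_nat.
move: q pq => [n| |] //; rewrite /N_ /= ?leey//.
Qed.

Theorem corollary13 (R : realType) (G H E F : completeNormedModType R)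
    (X : set G) (Y : set H) (p q : \bar int)
    (T : {linear CpType p X E -> CpType q Y F}) :
  open X -> open Y -> (1 <= p)%E -> (0 <= q)%E -> has_bump G p ->
  separating T -> nowhere_trivial T -> continuous T ->
  (p < q)%E ->
  exists h : Y -> X, is_support_map T h /\
    exists (I : Type) (Y_ : I -> set Y),
      [/\ partition [set: I] Y_ [set: Y],
          forall i, clopen (Y_ i) &
          forall i, exists x, forall y, Y_ i y -> h y = x].
Proof.
move=> oX oY p1 q0 bump sepT ntT cT pq.
have [m [pm mp qm]] := finite_smoothness p1 pq.
have p0 : N_ p 0 by apply: (N_leq pm).
have [h hP] := choice (fun y : Y =>
  support_pt_exists oX pm mp cT y q0 bump ntT).
have [phi [phi1 phi0 hub]] := bump.
have [M M0 hM] := has_bump_bound pm hub.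
have lc y : \forall z \near y, h z = h y.
  exact: (support_locally_constant oX oY pm mp qm sepT cT hP phi1 phi0 M0 hM).
exists h; split => [y|]; first exact: (support_pt_bigcap oX p0 sepT).
have oh (A : set X) : open (h @^-1` A).
  rewrite openE => y Ay; rewrite /interior.
  by apply: (@filterS _ _ (nbhs_filter y)) (lc y) => z /= ->.
exists (range h), (fun x => h @^-1` [set val x]); split.
- split.
  + apply/seteqP; split => // y _.
    by exists (SigSub (mem_set (imageT h y))).
  + by move=> x x' _ _ [y [/= yx yx']]; apply/val_inj; exact: etrans (esym yx) yx'.
  + by move=> x _; have [y _ yx] := set_valP x; exists y.
- by move=> x; split; [exact: oh|rewrite -openC; exact: (oh (~` [set val x]))].
- by move=> x; exists (val x).
Qed.
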